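(* Let $(M,\alpha_1,\alpha_2,\phi,g)$ be a metric contact pair with decomposable $\phi$, and let $N$ be a $\phi$-invariant submanifold of $M$ of dimension $\geq 3$ which is nowhere tangent and nowhere orthogonal to the Reeb vector fields $Z_1$ and $Z_2$. Along $N$ set $\zeta=\frac{1}{\Vert Z_1^T\Vert}Z_1^T$ and $\omega=g(\zeta,\cdot)$, where $Z_1^T$ is the tangential part of $Z_1$. Then (1) $\omega$ induces a contact form on $N$ with Reeb vector field $\zeta$; (2) $(\phi,\zeta,\omega,g)$ induces an almost contact metric structure on $N$, which is not contact metric. If the metric contact pair is normal, the induced almost contact structure on $N$ is normal.
   Context: All objects are smooth. A contact pair of type $(h,k)$ on a manifold $M$ of dimension $2h+2k+2$ is a pair of $1$-forms $(\alpha_1,\alpha_2)$ such that $\alpha_1\wedge(d\alpha_1)^h\wedge\alpha_2\wedge(d\alpha_2)^k$ is a volume form, $(d\alpha_1)^{h+1}=0$ and $(d\alpha_2)^{k+1}=0$. Convention: $2\,d\alpha(X,Y)=X\alpha(Y)-Y\alpha(X)-\alpha([X,Y])$ for $1$-forms. For $i=1,2$, the integrable subbundle $T\mathcal{F}_i=\{X:\alpha_i(X)=0,\ d\alpha_i(X,Y)=0\ \forall Y\}$ defines the characteristic foliation $\mathcal{F}_i$ of $\alpha_i$. The Reeb vector fields $Z_1,Z_2$ are the unique vector fields with $\alpha_i(Z_j)=\delta_{ij}$ and $i_{Z_i}d\alpha_j=0$ for all $i,j\in\{1,2\}$. A contact pair structure $(\alpha_1,\alpha_2,\phi)$ is a contact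 pair together with a $(1,1)$-tensor field $\phi$ with $\phi^2=-\mathrm{Id}+\alpha_1\otimes Z_1+\alpha_2\otimes Z_2$ and $\phi Z_1=\phi Z_2=0$. $\phi$ is decomposable if $\phi(T\mathcal{F}_i)\subset T\mathcal{F}_i$ for $i=1,2$. The structure is normal if both almost complex structures $J=\phi-\alpha_2\otimes Z_1+\alpha_1\otimes Z_2$ and $T=\phi+\alpha_2\otimes Z_1-\alpha_1\otimes Z_2$ are integrable; equivalently, $[\phi,\phi](X,Y)+2d\alpha_1(X,Y)Z_1+2d\alpha_2(X,Y)Z_2=0$ for all $X,Y$, where $[\phi,\phi](X,Y)=\phi^2[X,Y]+[\phi X,\phi Y]-\phi[\phi X,Y]-\phi[X,\phi Y]$. A metric contact pair $(M,\alpha_1,\alpha_2,\phi,g)$ is a contact pair structure with a Riemannian metric $g$ that is associated: $g(X,\phi Y)=(d\alpha_1+d\alpha_2)(X,Y)$ and $g(X,Z_i)=\alpha_i(X)$ for $i=1,2$ and all $X,Y$. A submanifold $N\subset M$ is $\phi$-invariant if $\phi(TN)\subset TN$. An almost contact metric structure $(\phi,\zeta,\omega,g)$ on an odd-dimensional manifold satisfies $\phi^2=-\mathrm{Id}+\omega\otimes\zeta$, $\omega(\zeta)=1$, $\phi\zeta=0$, $\omega\circ\phi=0$ and $g(\phi X,\phi Y)=g(X,Y)-\omega(X)\omega(Y)$. It is contact metric if moreover $g$ is associated, i.e. $g(X,\zeta)=\omega(X)$ and $g(X,\phi Y)=d\omega(X,Y)$ for all $X,Y$. It is normal if $[\phi,\phi]+2d\omega\otimes\zeta=0$.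 The Reeb vector field of a contact form $\omega$ is the unique $\zeta$ with $\omega(\zeta)=1$, $i_\zeta d\omega=0$. *)

(* Defs.v *)
From HB Require Import structures.
From mathcomp Require Import all_boot all_order all_algebra all_fingroup.
From mathcomp Require Import all_classical all_reals all_analysis.
Set Implicit Arguments.
Unset Strict Implicit.
Unset Printing Implicit Defensive.
Import Order.TTheory GRing.Theory Num.Theory.
Import numFieldNormedType.Exports.
Local Open Scope classical_set_scope.
Local Open Scope ring_scope.

(** * Smooth manifolds *)

(* All partial derivatives of order at most k exist and are continuous on U
   (an open set in every use below). *)
Fixpoint diff_class {R : realType} {n : nat} (k : nat) (U : set 'rV[R]_n)
    (f : 'rV[R]_n -> R) : Prop :=
  (forall x, U x -> {for x, continuous f}) /\
  if k is k'.+1 then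
    forall i : 'I_n, (forall x, U x -> derivable f x (delta_mx 0 i)) /\
      diff_class k' U (fun x => 'D_(delta_mx 0 i) f x)
  else True.

Definition smooth_on {R : realType} {n : nat} (U : set 'rV[R]_n)
    (f : 'rV[R]_n -> R) : Prop :=
  forall k, diff_class k U f.

(* [cmap] and [cinv] are only meaningful on [cdom] and on [cmap @` cdom]. *)
Record chart (R : realType) (T : topologicalType) (n : nat) := Chart {
  cdom : set T;
  cmap :> T -> 'rV[R]_n;
  cinv : 'rV[R]_n -> T;
  cdom_open : open cdom;
  cimg_open : open (cmap @` cdom);
  cmapK : forall x, cdom x -> cinv (cmap x) = x;
  cmap_continuous : forall x, cdom x -> {for x, continuous cmap};
  cinv_continuous : forall y, (cmap @` cdom) y -> {for y, continuous cinv} }.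

Definition smooth_transition {R : realType} {T : topologicalType} {n : nat}
    (c d : chart R T n) : Prop :=
  forall i : 'I_n,
    smooth_on (c @` (cdom c `&` cdom d)) (fun y => d (cinv c y) 0 i).

Definition compatible {R : realType} {T : topologicalType} {n : nat}
    (c d : chart R T n) : Prop :=
  smooth_transition c d /\ smooth_transition d c.

(* The atlas need not be maximal. *)
Record manifold (R : realType) (n : nat) := Manifold {
  mspace :> topologicalType;
  atlas : set (chart R mspace n);
  mspace_hausdorff : hausdorff_space mspace;
  mspace_second_countable : @second_countable mspace;
  atlas_cover : forall p : mspace, exists2 c, atlas c & cdom c p;
  atlas_compatible : forall c d, atlas c -> atlas d -> compatible c d }.

(* f is smooth on some neighbourhood of p. *)
Definition smooth_at {R : realType} {n : nat} {M : manifold R n} (p : M)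
    (f : M -> R) : Prop :=
  forall c, @atlas R n M c -> cdom c p ->
    exists U : set 'rV[R]_n, [/\ open U, U (c p), U `<=` c @` cdom c &
      smooth_on U (f \o cinv c)].

Definition smooth_map {R : realType} {m n : nat} {N : manifold R n}
    {M : manifold R m} (F : N -> M) : Prop :=
  continuous F /\
  forall (p : N) (f : M -> R), smooth_at (F p) f -> smooth_at p (f \o F).

(** * Tangent vectors and vector fields *)

(* Derivations at p of the algebra of germs of smooth functions.  A germ is
   represented by any total function smooth near p; the value on functions that
   are not smooth near p is set to 0, so that equality of tangent vectors is
   equality of derivations. *)
Definition derivation {R : realType} {n : nat} {M : manifold R n} (p : M)
    (v : (M -> R) -> R) : Prop :=
  (forall f, ~ smooth_at p f -> v f = 0) /\
  (forall f g, smooth_at p f -> smooth_at p g ->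
    [/\ (\forall q \near p, f q = g q) -> v f = v g,
        forall a : R, v (fun q => a * f q + g q) = a * v f + v g &
        v (fun q => f q * g q) = v f * g p + f p * v g]).

Definition derivations {R : realType} {n : nat} {M : manifold R n} (p : M) :
  {pred ((M -> R) -> R)} := fun v => `[< derivation p v >].

Lemma derivations_submod {R : realType} {n : nat} {M : manifold R n} (p : M) :
  submod_closed (@derivations R n M p).
Proof.
split.
  apply/asboolP; split=> // f g _ _; split=> //.
  - by move=> a; change (0 = a * 0 + 0 :> R); rewrite mulr0 addr0.
  - by change (0 = 0 * g p + f p * 0 :> R); rewrite mul0r mulr0 addr0.
move=> a u v /asboolP[u0 uP] /asboolP[v0 vP]; apply/asboolP.
have E f : (a *: u + v) f = a * u f + v f by [].
split=> [f Nf|f g sf sg]; first by rewrite E u0 // v0 // mulr0 addr0.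
have [u1 u2 u3] := uP f g sf sg; have [v1 v2 v3] := vP f g sf sg.
split=> [fg|b|]; rewrite !E.
- by rewrite u1 // v1.
- by rewrite u2 v2 !mulrDr addrACA mulrCA.
- by rewrite u3 v3 !mulrDr !mulrDl addrACA (mulrCA a (f p)) !mulrA.
Qed.

HB.instance Definition _ (R : realType) (n : nat) (M : manifold R n) (p : M) :=
  GRing.isSubmodClosed.Build R ((M -> R) -> R) (@derivations R n M p)
    (@derivations_submod R n M p).

Record tangent {R : realType} {n : nat} {M : manifold R n} (p : M) : Type :=
  Tangent { tangent_val :> (M -> R) -> R;
            _ : tangent_val \in derivations p }.

HB.instance Definition _ (R : realType) (n : nat) (M : manifold R n) (p : M) :=
  [isSub of tangent p for @tangent_val R n M p].
HB.instance Definition _ (R : realType) (n : nat) (M : manifold R n) (p : M) :=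
  [Choice of tangent p by <:].
HB.instance Definition _ (R : realType) (n : nat) (M : manifold R n) (p : M) :=
  [SubChoice_isSubLmodule of tangent p by <:].

(* The tangent vector at p acting as D on functions smooth near p;
   0 when D does not define a derivation there. *)
Definition tangent_of {R : realType} {n : nat} {M : manifold R n} (p : M)
    (D : (M -> R) -> R) : tangent p :=
  insubd (0 : tangent p) (fun f => if `[< smooth_at p f >] then D f else 0).

Definition vfield {R : realType} {n : nat} (M : manifold R n) : Type :=
  forall p : M, tangent p.

Definition smooth_vf_at {R : realType} {n : nat} {M : manifold R n} (p : M)
    (X : vfield M) : Prop :=
  forall f : M -> R, smooth_at p f -> smooth_at p (fun q => X q f).

Definition smooth_vf {R : realType} {n : nat} {M : manifold R n}
    (X : vfield M) : Prop :=
  forall p, smooth_vf_at p X.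

Definition lie {R : realType} {n : nat} {M : manifold R n} (X Y : vfield M) :
    vfield M :=
  fun p => tangent_of p (fun f => X p (fun q => Y q f) - Y p (fun q => X q f)).

Definition differential {R : realType} {m n : nat} {N : manifold R n}
    {M : manifold R m} (F : N -> M) (p : N) (u : tangent p) : tangent (F p) :=
  tangent_of (F p) (fun f => u (f \o F)).

(* An injective immersion; embedded submanifolds are a special case. *)
Definition submanifold {R : realType} {m n : nat} {N : manifold R n}
    {M : manifold R m} (i : N -> M) : Prop :=
  [/\ smooth_map i, injective i & forall p : N, injective (@differential R m n N M i p)].

(** * Tensor fields *)

Definition covector_field {R : realType} {n : nat} (M : manifold R n) : Type :=
  forall p : M, tangent p -> R.

Definition endo_field {R : realType} {n : nat} (M : manifold R n) : Type :=
  forall p : M, tangent p -> tangent p.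

Definition bilin_field {R : realType} {n : nat} (M : manifold R n) : Type :=
  forall p : M, tangent p -> tangent p -> R.

Definition one_form {R : realType} {n : nat} {M : manifold R n}
    (a : covector_field M) : Prop :=
  (forall p, scalar (a p)) /\
  (forall p (X : vfield M), smooth_vf_at p X -> smooth_at p (fun q => a q (X q))).

Definition tensor11 {R : realType} {n : nat} {M : manifold R n}
    (phi : endo_field M) : Prop :=
  (forall p, linear (phi p)) /\
  (forall p (X : vfield M), smooth_vf_at p X ->
    smooth_vf_at p (fun q => phi q (X q))).

Definition riemannian {R : realType} {n : nat} {M : manifold R n}
    (g : bilin_field M) : Prop :=
  [/\ forall p (u : tangent p), scalar (g p u),
      forall p (u v : tangent p), g p u v = g p v u,
      forall p (u : tangent p), u != 0 -> 0 < g p u u &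
      forall p (X Y : vfield M), smooth_vf_at p X -> smooth_vf_at p Y ->
        smooth_at p (fun q => g q (X q) (Y q))].

(** * Exterior calculus *)

(* The value of [2 da(X,Y) = X a(Y) - Y a(X) - a([X,Y])] at p for any fields
   X, Y, smooth near p, that extend u and v. *)
Definition extd {R : realType} {n : nat} {M : manifold R n}
    (a : covector_field M) : bilin_field M :=
  fun p u v => xget 0 [set r : R | exists X Y : vfield M,
    [/\ smooth_vf_at p X, smooth_vf_at p Y, X p = u, Y p = v &
        2 * r = X p (fun q => a q (Y q)) - Y p (fun q => a q (X q))
                - a p (lie X Y p)]].

Definition form {R : realType} {n : nat} (M : manifold R n) (j : nat) : Type :=
  forall p : M, ('I_j -> tangent p) -> R.

Definition form0 {R : realType} {n : nat} {M : manifold R n} : form M 0 :=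
  fun _ _ => 1.

Definition form1 {R : realType} {n : nat} {M : manifold R n}
    (a : covector_field M) : form M 1 :=
  fun p v => a p (v ord0).

Definition form2 {R : realType} {n : nat} {M : manifold R n}
    (b : bilin_field M) : form M 2 :=
  fun p v => b p (v ord0) (v ord_max).

(* Normalized by 1/(j+l)!, consistently with the factor 2 in [extd]. *)
Definition wedge {R : realType} {n : nat} {M : manifold R n} {j l : nat}
    (a : form M j) (b : form M l) : form M (j + l) :=
  fun p v => ((j + l)`!%:R)^-1 * \sum_(s : 'S_(j + l))
    (-1) ^+ s * a p (fun x => v (s (lshift l x))) * b p (fun x => v (s (rshift j x))).

Fixpoint wedge_pow {R : realType} {n : nat} {M : manifold R n} {j : nat}
    (b : form M j) (l : nat) : form M (l * j) :=
  if l is l'.+1 return form M (l * j) then wedge b (@wedge_pow R n M j b l')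
  else form0.
Arguments wedge_pow {R n M j} b l _ _.

Definition form_zero {R : realType} {n : nat} {M : manifold R n} {j : nat}
    (a : form M j) : Prop :=
  forall p v, a p v = 0.

Definition volume_form {R : realType} {n : nat} {M : manifold R n} {j : nat}
    (a : form M j) : Prop :=
  j = n /\ forall p, exists v, a p v != 0.

(** * Contact forms and almost contact metric structures *)

Definition contact_form {R : realType} {n : nat} {M : manifold R n}
    (w : covector_field M) : Prop :=
  one_form w /\
  exists m, volume_form (wedge (form1 w) (wedge_pow (form2 (extd w)) m)).

Definition reeb_field {R : realType} {n : nat} {M : manifold R n}
    (w : covector_field M) (z : vfield M) : Prop :=
  smooth_vf z /\
  forall p, w p (z p) = 1 /\ forall u, extd w (z p) u = 0.

(* [phi,phi](X,Y) *)
Definition nijenhuis {R : realType} {n : nat} {M : manifold R n}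
    (phi : endo_field M) (X Y : vfield M) : vfield M :=
  let pX q := phi q (X q) in
  let pY q := phi q (Y q) in
  fun p => phi p (phi p (lie X Y p)) + lie pX pY p
           - phi p (lie pX Y p) - phi p (lie X pY p).

Definition almost_contact_metric {R : realType} {n : nat} {M : manifold R n}
    (phi : endo_field M) (z : vfield M) (w : covector_field M)
    (g : bilin_field M) : Prop :=
  [/\ odd n, [/\ tensor11 phi, smooth_vf z, one_form w & riemannian g] &
   forall p (u v : tangent p),
     [/\ phi p (phi p u) = - u + w p u *: z p,
         w p (z p) = 1,
         phi p (z p) = 0,
         w p (phi p u) = 0 &
         g p (phi p u) (phi p v) = g p u v - w p u * w p v]].

Definition contact_metric {R : realType} {n : nat} {M : manifold R n}
    (phi : endo_field M) (z : vfield M) (w : covector_field M)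
    (g : bilin_field M) : Prop :=
  almost_contact_metric phi z w g /\
  forall p (u v : tangent p),
    g p u (z p) = w p u /\ g p u (phi p v) = extd w u v.

Definition normal_almost_contact {R : realType} {n : nat} {M : manifold R n}
    (phi : endo_field M) (z : vfield M) (w : covector_field M) : Prop :=
  forall X Y : vfield M, smooth_vf X -> smooth_vf Y ->
    forall p, nijenhuis phi X Y p + (2 * extd w (X p) (Y p)) *: z p = 0.

(** * Metric contact pairs *)

Definition contact_pair {R : realType} {n : nat} {M : manifold R n} (h k : nat)
    (a1 a2 : covector_field M) : Prop :=
  let da1 := form2 (extd a1) in
  let da2 := form2 (extd a2) in
  [/\ n = (2 * h + 2 * k + 2)%N,
      one_form a1 /\ one_form a2,
      volume_form (wedge (wedge (wedge (form1 a1) (wedge_pow da1 h))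
                                (form1 a2)) (wedge_pow da2 k)),
      form_zero (wedge_pow da1 h.+1) &
      form_zero (wedge_pow da2 k.+1)].

Definition reeb_pair {R : realType} {n : nat} {M : manifold R n}
    (a1 a2 : covector_field M) (Z1 Z2 : vfield M) : Prop :=
  [/\ smooth_vf Z1, smooth_vf Z2 &
   forall p,
     [/\ a1 p (Z1 p) = 1, a1 p (Z2 p) = 0, a2 p (Z1 p) = 0, a2 p (Z2 p) = 1 &
         forall u : tangent p,
           [/\ extd a1 (Z1 p) u = 0, extd a2 (Z1 p) u = 0,
               extd a1 (Z2 p) u = 0 & extd a2 (Z2 p) u = 0]]].

Definition contact_pair_structure {R : realType} {n : nat} {M : manifold R n}
    (h k : nat) (a1 a2 : covector_field M) (Z1 Z2 : vfield M)
    (phi : endo_field M) : Prop :=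
  [/\ contact_pair h k a1 a2, reeb_pair a1 a2 Z1 Z2, tensor11 phi &
   forall p (u : tangent p),
     [/\ phi p (phi p u) = - u + a1 p u *: Z1 p + a2 p u *: Z2 p,
         phi p (Z1 p) = 0 & phi p (Z2 p) = 0]].

Definition metric_contact_pair {R : realType} {n : nat} {M : manifold R n}
    (h k : nat) (a1 a2 : covector_field M) (Z1 Z2 : vfield M)
    (phi : endo_field M) (g : bilin_field M) : Prop :=
  [/\ contact_pair_structure h k a1 a2 Z1 Z2 phi, riemannian g &
   forall p (u v : tangent p),
     [/\ g p u (phi p v) = extd a1 u v + extd a2 u v,
         g p u (Z1 p) = a1 p u & g p u (Z2 p) = a2 p u]].

(* The fibre at p of the tangent bundle of the characteristic foliation. *)
Definition char_dist {R : realType} {n : nat} {M : manifold R n}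
    (a : covector_field M) (p : M) : set (tangent p) :=
  [set u | a p u = 0 /\ forall v, extd a u v = 0].

Definition decomposable {R : realType} {n : nat} {M : manifold R n}
    (a1 a2 : covector_field M) (phi : endo_field M) : Prop :=
  forall p (u : tangent p),
    (char_dist a1 u -> char_dist a1 (phi p u)) /\
    (char_dist a2 u -> char_dist a2 (phi p u)).

(* Around each point there are local coordinates (x_i, y_i), with y_i the
   coordinate of index i + m, such that J (d/dx_i) = d/dy_i; dually,
   dx_i o J = - dy_i and dy_i o J = dx_i. *)
Definition integrable_acs {R : realType} {n : nat} {M : manifold R n}
    (J : endo_field M) : Prop :=
  exists2 m, n = (2 * m)%N & forall p : M, exists c : chart R M n,
    [/\ forall d, @atlas R n M d -> compatible c d, cdom c p &
     forall q, cdom c q -> forall (u : tangent q) (i j : 'I_n),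
       j = (i + m)%N :> nat ->
       J q u (fun x => c x 0 i) = - u (fun x => c x 0 j) /\
       J q u (fun x => c x 0 j) = u (fun x => c x 0 i)].

Definition normal_contact_pair {R : realType} {n : nat} {M : manifold R n}
    (a1 a2 : covector_field M) (Z1 Z2 : vfield M) (phi : endo_field M) : Prop :=
  integrable_acs (fun p u => phi p u - a2 p u *: Z1 p + a1 p u *: Z2 p) /\
  integrable_acs (fun p u => phi p u + a2 p u *: Z1 p - a1 p u *: Z2 p).

(** * Structures induced on a submanifold *)

Definition phi_invariant {R : realType} {m n : nat} {N : manifold R n}
    {M : manifold R m} (i : N -> M) (phi : endo_field M) : Prop :=
  forall p : N, phi (i p) @` range (@differential R m n N M i p) `<=`
                range (@differential R m n N M i p).

Definition nowhere_tangent {R : realType} {m n : nat} {N : manifold R n}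
    {M : manifold R m} (i : N -> M) (Z : vfield M) : Prop :=
  forall p : N, ~ range (@differential R m n N M i p) (Z (i p)).

Definition nowhere_orthogonal {R : realType} {m n : nat} {N : manifold R n}
    {M : manifold R m} (i : N -> M) (g : bilin_field M) (Z : vfield M) : Prop :=
  forall p : N, ~ forall u : tangent p, g (i p) (Z (i p)) (differential i u) = 0.

Definition induced_endo {R : realType} {m n : nat} {N : manifold R n}
    {M : manifold R m} (i : N -> M) (phi : endo_field M) : endo_field N :=
  fun p u => xget 0 [set v | differential i v = phi (i p) (differential i u)].

Definition induced_metric {R : realType} {m n : nat} {N : manifold R n}
    {M : manifold R m} (i : N -> M) (g : bilin_field M) : bilin_field N :=
  fun p u v => g (i p) (differential i u) (differential i v).

(* The vector field on N that is the g-orthogonal projection of Z. *)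
Definition tangential_part {R : realType} {m n : nat} {N : manifold R n}
    {M : manifold R m} (i : N -> M) (g : bilin_field M) (Z : vfield M) :
    vfield N :=
  fun p => xget 0 [set v | forall u : tangent p,
    g (i p) (Z (i p) - differential i v) (differential i u) = 0].

Definition normalized {R : realType} {n : nat} {M : manifold R n}
    (g : bilin_field M) (X : vfield M) : vfield M :=
  fun p => (Num.sqrt (g p (X p) (X p)))^-1 *: X p.

Definition dual_form {R : realType} {n : nat} {M : manifold R n}
    (g : bilin_field M) (X : vfield M) : covector_field M :=
  fun p u => g p (X p) u.

(* Main.v *)
Require Import Defs.
From mathcomp Require Import all_boot all_order all_algebra all_fingroup.
From mathcomp Require Import all_classical all_reals all_analysis.
From mathcomp Require Import ring zify.
Import Order.TTheory GRing.Theory Num.Theory.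
Import numFieldNormedType.Exports.
Local Open Scope classical_set_scope.
Local Open Scope ring_scope.

(** Since phi is skew for g and preserves both the tangent spaces of N and their
    orthogonal complements, it kills the tangential part of Z1, because it kills
    Z1. That tangential part therefore lies in the plane of Z1 and Z2, and along
    N the unit field is zeta = c Z1 + s Z2 with c, s functions on N such that
    c^2 + s^2 = 1; c > 0 as Z1 is nowhere orthogonal to N, and s is nowhere zero
    as Z1 is nowhere tangent ([zetaE], [cosine_gt0], [sine_neq0]). The vector
    - s Z1 + c Z2 is normal to N, so a1 = c omega and a2 = s omega on N. Exterior
    differentiation, contracted with zeta, gives i_zeta (d omega) = 0 and then
    da1 = c d omega, da2 = s d omega ([extd_omega_zeta], [gN_phiN]). Hence
    g(X, phi Y) = (c + s) d omega (X, Y) on N. As the left side is nondegenerate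
    on the kernel of omega, which is not zero, c + s never vanishes and omega is
    a contact form; in a frame zeta, e, phi e, e', phi e', ... all the terms of
    omega /\ (d omega)^l have the same sign ([wedge_pow_symplectic],
    [frame_symplectic]). The structure is contact metric only if c + s = 1, which
    would give c s = 0.

    For normality, both almost complex structures coincide with phi on the
    kernel of omega, so their integrability, expressed in adapted coordinates
    and pulled back to N ([integrable_along]), settles the torsion of two fields
    in that kernel ([nijenhuis_horizontal]). For zeta and a field of the kernel
    one needs [zeta, phi Y] = phi [zeta, Y]: on M the fields Z1 and Z2 preserve
    phi on the common kernel of a1 and a2 ([reeb_lie_phi]), and this passes to N
    by the Leibniz rule for brackets along a map ([lie_zeta_phiN]). Tensoriality
    of the torsion concludes ([induced_normal]).

    These arguments rest on the calculus of derivations. Its analytic core is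
    Hadamard's lemma with smooth quotients ([hadamardE], [hadamard_diff_class]):
    it yields the chain rule, hence the independence of smoothness from the
    chart, and the coordinate expression of tangent vectors ([tangent_coordE]),
    from which the exterior derivative of a one-form is seen not to depend on
    the extensions used to define it ([extdE]). *)

Set Implicit Arguments.
Unset Strict Implicit.
Unset Printing Implicit Defensive.

Section ScalarFunctional.
Context {R : realType} {V : lmodType R} {L : V -> R}.
Hypothesis sL : scalar L.

Lemma scalar_fun0 : L 0 = 0.
Proof. by have := sL (-1) 0 0; rewrite scaleN1r addNr mulN1r addNr. Qed.

Lemma scalar_funD u v : L (u + v) = L u + L v.
Proof. by have := sL 1 u v; rewrite scale1r mul1r. Qed.

Lemma scalar_funZ b u : L (b *: u) = b * L u.
Proof. by have := sL b u 0; rewrite scalar_fun0 !addr0. Qed.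

Lemma scalar_fun_sum (I : Type) (r : seq I) (P : pred I) (F : I -> V) :
  L (\sum_(i <- r | P i) F i) = \sum_(i <- r | P i) L (F i).
Proof. exact: (big_morph L scalar_funD scalar_fun0). Qed.

End ScalarFunctional.

(** * Functions of class C^k on open subsets of R^n *)

Section DiffClass.
Context {R : realType} {n : nat}.
Implicit Types (U V : set 'rV[R]_n) (f g : 'rV[R]_n -> R).

Lemma diff_class_continuous k U f x :
  diff_class k U f -> U x -> {for x, continuous f}.
Proof. by case: k => [|k] [+ _]; apply. Qed.

Lemma diff_class_derivable k U f x i :
  diff_class k.+1 U f -> U x -> derivable f x (delta_mx 0 i).
Proof. by move=> [_ /(_ i)[+ _]]; apply. Qed.

Lemma diff_class_le j k U f : (j <= k)%N -> diff_class k U f -> diff_class j U f.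
Proof.
elim: j k f => [|j IH] [|k] f //=; first by move=> _ [].
rewrite ltnS => jk [cf df]; split=> // i; have [d1 d2] := df i.
by split=> //; exact: IH d2.
Qed.

Lemma diff_class_sub k U V f : V `<=` U -> diff_class k U f -> diff_class k V f.
Proof.
move=> VU; elim: k f => [|k IH] f [cf df]; split=> //.
- by move=> x /VU/cf.
- by move=> x /VU/cf.
- move=> i; have [d1 d2] := df i; split; last exact: IH.
  by move=> x /VU/d1.
Qed.

Lemma near_open_eq U f g x : open U -> U x -> (forall y, U y -> f y = g y) ->
  {near x, f =1 g}.
Proof. by move=> oU Ux fg; apply: filterS (open_nbhs_nbhs (conj oU Ux)). Qed.

Lemma near_eq_continuous_at (S T : topologicalType) (f g : S -> T) x :
  (\forall y \near x, f y = g y) -> {for x, continuous f} ->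
  {for x, continuous g}.
Proof.
move=> fg cf; rewrite /prop_for /continuous_at -(nbhs_singleton fg).
by apply: cvg_trans cf; apply: near_eq_cvg.
Qed.

Lemma diff_class_ext k U f g : open U -> (forall y, U y -> f y = g y) ->
  diff_class k U f -> diff_class k U g.
Proof.
move=> oU; elim: k f g => [|k IH] f g fg [cf df]; split=> //.
- by move=> x Ux; apply: near_eq_continuous_at (cf x Ux); exact: near_open_eq fg.
- by move=> x Ux; apply: near_eq_continuous_at (cf x Ux); exact: near_open_eq fg.
- move=> i; have [d1 d2] := df i; split.
    move=> x Ux; apply: near_eq_derivable (d1 x Ux); exact: near_open_eq fg.
  apply: IH d2 => y Uy; apply: near_eq_derive; exact: near_open_eq fg.
Qed.

Lemma diff_class_cst k U (a : R) : diff_class k U (fun=> a).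
Proof.
elim: k a => [|k IH] a; split=> //.
- by move=> x _; exact: cst_continuous.
- by move=> x _; exact: cst_continuous.
- move=> i; split=> [x _|]; first exact: derivable_cst.
  by under eq_fun do rewrite derive_cst; exact: IH.
Qed.

Lemma is_derive_coord (j : 'I_n) (x v : 'rV[R]_n) :
  is_derive x v (fun y : 'rV[R]_n => y 0 j : R) (v 0 j).
Proof.
have H : (fun h : R => h^-1 *: (((h *: v + x) 0 j : R) - x 0 j)) @ 0^' --> v 0 j.
  apply: (@cvg_trans _ ((fun=> v 0 j : R) @ 0^')); last exact: cvg_cst.
  apply: near_eq_cvg; near=> h.
  rewrite mxE mxE addrK scalerA mulVf ?scale1r //.
  near: h; exact: nbhs_dnbhs_neq.
apply: DeriveDef; first by apply/cvg_ex; exists (v 0 j).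
exact: cvg_lim H.
Unshelve. all: by end_near.
Qed.

Lemma diff_class_coord k U (j : 'I_n) : diff_class k U (fun y => y 0 j).
Proof.
case: k => [|k]; split=> //.
- by move=> x _; exact: coord_continuous.
- by move=> x _; exact: coord_continuous.
- move=> i; split=> [x _|].
    by have [] := is_derive_coord j x (delta_mx 0 i).
  under eq_fun => x do rewrite (@derive_val _ _ _ _ _ _ _ (is_derive_coord j x _)).
  exact: diff_class_cst.
Qed.

Lemma diff_classD k U f g : open U -> diff_class k U f -> diff_class k U g ->
  diff_class k U (fun x => f x + g x).
Proof.
move=> oU; elim: k f g => [|k IH] f g [cf df] [cg dg]; split=> //.
- by move=> x Ux; apply: continuousD; [exact: cf|exact: cg].
- by move=> x Ux; apply: continuousD; [exact: cf|exact: cg].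
- move=> i; have [df1 df2] := df i; have [dg1 dg2] := dg i.
  split=> [x Ux|]; first by apply: derivableD; [exact: df1|exact: dg1].
  apply: diff_class_ext (IH _ _ df2 dg2) => // x Ux.
  by rewrite -deriveD //; [exact: df1|exact: dg1].
Qed.

Lemma diff_classM k U f g : open U -> diff_class k U f -> diff_class k U g ->
  diff_class k U (fun x => f x * g x).
Proof.
move=> oU; elim: k f g => [|k IH] f g Hf Hg;
  have [cf df] := Hf; have [cg dg] := Hg; split=> //.
- by move=> x Ux; apply: continuousM; [exact: cf|exact: cg].
- by move=> x Ux; apply: continuousM; [exact: cf|exact: cg].
- move=> i; have [df1 df2] := df i; have [dg1 dg2] := dg i.
  split=> [x Ux|]; first by apply: derivableM; [exact: df1|exact: dg1].
  have Hf' := diff_class_le (leqnSn k) Hf; have Hg' := diff_class_le (leqnSn k) Hg.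
  apply: diff_class_ext (diff_classD oU (IH _ _ Hf' dg2) (IH _ _ Hg' df2)) => //.
  move=> x Ux; rewrite -[X in _ = X]/('D_(delta_mx 0 i) (f * g) x).
  by rewrite deriveM //; [exact: df1|exact: dg1].
Qed.

Lemma diff_class_sum k U (I : Type) (r : seq I) (P : pred I)
    (F : I -> 'rV[R]_n -> R) : open U ->
  (forall i, P i -> diff_class k U (F i)) ->
  diff_class k U (fun x => \sum_(i <- r | P i) F i x).
Proof.
move=> oU HF; elim: r => [|i r IH].
  by under eq_fun do rewrite big_nil; exact: diff_class_cst.
have [Pi|nPi] := boolP (P i).
  by under eq_fun do rewrite big_cons Pi; apply: diff_classD (HF _ Pi) IH.
by under eq_fun do rewrite big_cons (negbTE nPi).
Qed.

Lemma diff_classV k U f : open U -> (forall x, U x -> f x != 0) ->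
  diff_class k U f -> diff_class k U (fun x => (f x)^-1).
Proof.
move=> oU f0; elim: k => [|k IH] Hf; have [cf df] := Hf; split=> //.
- by move=> x Ux; apply: continuousV; [exact: f0|exact: cf].
- by move=> x Ux; apply: continuousV; [exact: f0|exact: cf].
- move=> i; have [df1 df2] := df i.
  split=> [x Ux|]; first by apply: derivableV; [exact: f0|exact: df1].
  have Hi := IH (diff_class_le (leqnSn k) Hf).
  have H1 := diff_classM oU (diff_class_cst k U (-1)) (diff_classM oU Hi Hi).
  apply: diff_class_ext (diff_classM oU H1 df2) => //.
  move=> x Ux; rewrite deriveV; [|exact: f0|exact: df1].
  by rewrite mulN1r -exprVn expr2.
Qed.

End DiffClass.

(** * Integrals depending on a parameter *)

Section ParamInt.
Context {R : realType}.
Local Notation mu := (@lebesgue_measure R).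

Lemma cvg_rV (n : nat) (T : Type) (F : set_system T) {FF : Filter F}
    (u : T -> 'rV[R]_n) (l : 'rV[R]_n) :
  (forall j, (u t 0 j : R) @[t --> F] --> (l 0 j : R)) -> u @ F --> l.
Proof.
move=> ul A [P lP sPA]; rewrite /= nbhs_simpl.
have : \forall t \near F, forall j : 'I_n, P 0 j (u t 0 j).
  by apply: filter_forall => j; apply: (ul j); exact: lP.
by apply: filterS => t Pt; apply: sPA => i j; rewrite ord1; exact: Pt.
Qed.

(** By compactness of [0, 1], closeness that is locally uniform in t is uniform. *)
Lemma cvg_Rintegral01 (T : Type) (F : set_system T) (FF : Filter F)
    (h : T -> R -> R) (h0 : R -> R) :
  (forall t : R, t \in `[0, 1] -> forall e : R, 0 < e ->
     \forall s \near t & y \near F, `|h0 s - h y s| < e) ->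
  {within `[0, 1], continuous h0} ->
  (\forall y \near F, {within `[0, 1], continuous (h y)}) ->
  (\int[mu]_(t in `[0, 1]) h y t) @[y --> F] --> \int[mu]_(t in `[0, 1]) h0 t.
Proof.
move=> H c0 cy; apply/cvgrPdist_le => e e0.
have : \forall y \near F, `[0, 1] `<=` [set t | `|h0 t - h y t| < e].
  have /compact_near_coveringP K := @segment_compact R 0 1.
  by apply: (K _ F (fun y t => `|h0 t - h y t| < e)) => t t01; exact: H.
apply: filterS2 cy => y cy He.
have I0 := continuous_compact_integrable (@segment_compact R 0 1) c0.
have Iy := continuous_compact_integrable (@segment_compact R 0 1) cy.
rewrite -RintegralB //.
have ID : mu.-integrable `[0, 1] (EFin \o (fun x => h0 x - h y x)).
  rewrite (_ : EFin \o _ = (EFin \o h0) \- (EFin \o h y))%E.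
    exact: integrableB.
  by apply/funext => x; rewrite /= EFinB.
apply: le_trans (le_normr_Rintegral _ ID) _ => //.
apply: (@le_trans _ _ (\int[mu]_(t in `[0, 1]) e)).
  apply: le_Rintegral => //.
  - exact: (integrable_abse ID).
  - apply: continuous_compact_integrable; first exact: segment_compact.
    by move=> x; exact: cst_continuous.
  - by move=> t /He /ltW.
rewrite Rintegral_cst //= lebesgue_measure_itv /= lte_fin ltr01 /=.
by rewrite oppr0 addr0 mulr1.
Qed.

End ParamInt.

Section Stretch.
Context {R : realType} {n : nat}.
Local Notation mu := (@lebesgue_measure R).
Implicit Types (p x y : 'rV[R]_n) (f : 'rV[R]_n -> R).

Definition stretch p (c : 'I_n -> R) x : 'rV[R]_n :=
  \row_j (p 0 j + c j * (x 0 j - p 0 j)).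

Lemma in_ball_rV p (r : R) x :
  ball p r x <-> 0 < r /\ forall j, `|p 0 j - x 0 j| < r.
Proof.
split=> [[r0 H]|[r0 H]]; split=> //; first by move=> j; exact: H.
by move=> i j; rewrite ord1; exact: H.
Qed.

Lemma stretch_ball p (r : R) c x : (forall j, 0 <= c j <= 1) ->
  ball p r x -> ball p r (stretch p c x).
Proof.
move=> c01 /in_ball_rV[r0 H]; apply/in_ball_rV; split=> // j.
have /andP[c0 c1] := c01 j.
rewrite mxE opprD addrA subrr sub0r normrN normrM (ger0_norm c0) distrC.
by apply: le_lt_trans (H j); rewrite ler_piMl.
Qed.

Lemma stretch_line p c (i : 'I_n) (h : R) x :
  stretch p c (h *: delta_mx 0 i + x) = (h * c i) *: delta_mx 0 i + stretch p c x.
Proof.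
apply/rowP => j; rewrite !mxE eqxx /=; case: eqP => [->|_] /=.
  by rewrite !mulr1 addrCA; congr (_ + _); ring.
by rewrite !mulr0 !add0r.
Qed.

Lemma is_derive_line f x (e : 'rV[R]_n) (u : R) :
  derivable f (u *: e + x) e ->
  is_derive u (1 : R) (fun s => f (s *: e + x)) ('D_e f (u *: e + x)).
Proof.
move=> df.
have E : (fun h : R => h^-1 *: ((fun s => f (s *: e + x)) (h *: 1 + u) -
      f (u *: e + x))) =
    (fun h : R => h^-1 *: (f (h *: e + (u *: e + x)) - f (u *: e + x))).
  by apply/funext => h; rewrite scalerDl addrA [h%:A]mulr1.
apply: DeriveDef; first by rewrite /derivable /= E.
by rewrite /derive /= E.
Qed.

Lemma is_derive_line_scaled f x (e : 'rV[R]_n) (c s : R) :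
  derivable f ((s * c) *: e + x) e ->
  is_derive s (1 : R) (fun s => f ((s * c) *: e + x))
    (c * 'D_e f ((s * c) *: e + x)).
Proof.
move=> /is_derive_line df; rewrite mulrC.
apply: (is_derive1_comp (f := fun u => f (u *: _ + _)) (g := fun s => s * c)) => //.
have -> : (fun s => s * c) = (c \*: (@id R)) by apply/funext => u /=; rewrite mulrC.
by apply: is_derive_eq; rewrite [LHS]mulr1.
Qed.

Lemma is_derive_stretch f p c (i : 'I_n) x (s : R) :
  derivable f (stretch p c (s *: delta_mx 0 i + x)) (delta_mx 0 i) ->
  is_derive s (1 : R) (fun s => f (stretch p c (s *: delta_mx 0 i + x)))
    (c i * 'D_(delta_mx 0 i) f (stretch p c (s *: delta_mx 0 i + x))).
Proof.
rewrite stretch_line => df; under eq_fun do rewrite stretch_line.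
exact: is_derive_line_scaled.
Qed.

Variables (p : 'rV[R]_n) (r : R).
Variable tau : R -> 'I_n -> R.
Hypothesis tau_cont : forall j, continuous (tau ^~ j).
Hypothesis tau01 : forall t, t \in `[0, 1] -> forall j, 0 <= tau t j <= 1.

(** Differentiating under the integral sign in the i-th direction only multiplies
    the weight by the i-th contraction factor; carrying a weight w makes this
    family of integrals closed under differentiation. *)
Definition param_int (w : R -> R) f x : R :=
  \int[mu]_(t in `[0, 1]) (w t * f (stretch p (tau t) x)).

Lemma stretch_cvg (t : R) x :
  stretch p (tau z.1) z.2 @[z --> (t, x)] --> stretch p (tau t) x.
Proof.
apply: cvg_rV => j; rewrite mxE; under eq_fun do rewrite mxE.
apply: cvgD; first exact: cvg_cst.
apply: cvgM.
  by apply: (cvg_comp _ (tau ^~ j) cvg_fst); exact: tau_cont.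
apply: cvgB; last exact: cvg_cst.
by apply: (cvg_comp _ (fun y : 'rV[R]_n => y 0 j) cvg_snd); exact: coord_continuous.
Qed.

Section WithWeight.
Variable w : R -> R.
Hypothesis w_cont : continuous w.

Lemma integrand_cvg f (t : R) x : t \in `[0, 1] -> ball p r x ->
  (forall y, ball p r y -> {for y, continuous f}) ->
  w z.1 * f (stretch p (tau z.1) z.2) @[z --> (t, x)] -->
  w t * f (stretch p (tau t) x).
Proof.
move=> t01 xb cf; apply: cvgM.
  by apply: (cvg_comp _ w cvg_fst); exact: w_cont.
apply: (cvg_comp _ f (stretch_cvg (t := t) (x := x))).
by apply: cf; apply: stretch_ball => //; exact: tau01.
Qed.

Lemma integrand_continuous f x : ball p r x ->
  (forall y, ball p r y -> {for y, continuous f}) ->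
  {within `[0, 1], continuous (fun t => w t * f (stretch p (tau t) x))}.
Proof.
move=> xb cf; apply: continuous_in_subspaceT => t; rewrite inE => t01.
have H := integrand_cvg t01 xb cf.
have L : (fun s : R => (s, x)) @ t --> nbhs (t, x).
  exact: (cvg_pair (@cvg_id _ (nbhs t)) (cvg_cst x)).
exact: (cvg_comp _ _ L H).
Qed.

Lemma integrand_near f (t : R) x (e : R) : t \in `[0, 1] -> ball p r x ->
  (forall y, ball p r y -> {for y, continuous f}) -> 0 < e ->
  \forall s \near t & y \near x,
    `|w s * f (stretch p (tau s) x) - w s * f (stretch p (tau s) y)| < e.
Proof.
move=> t01 xb cf e0; have H := integrand_cvg t01 xb cf.
have K : (w z.1 * f (stretch p (tau z.1) x)) @[z --> (t, x)] -->
  w t * f (stretch p (tau t) x).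
  have L : (fun z : R * 'rV[R]_n => (z.1, x)) @ nbhs (t, x) --> nbhs (t, x).
    exact: (cvg_pair cvg_fst (cvg_cst x)).
  exact: (cvg_comp _ _ L H).
have FF : Filter (nbhs (t, x)) by exact: nbhs_filter.
have L : (w z.1 * f (stretch p (tau z.1) x)
    - w z.1 * f (stretch p (tau z.1) z.2)) @[z --> (t, x)] --> (0 : R).
  by rewrite -(subrr (w t * f (stretch p (tau t) x))); exact: cvgB.
by move/cvgr0_norm_lt : L => /(_ _ e0); exact.
Qed.

Lemma near_ball_rV x : ball p r x -> \forall y \near x, ball p r y.
Proof.
by move=> xb; apply: open_nbhs_nbhs; split=> //; exact: ball_open.
Qed.

Lemma param_int_continuous f x : ball p r x ->
  (forall y, ball p r y -> {for y, continuous f}) ->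
  {for x, continuous (param_int w f)}.
Proof.
move=> xb cf; apply: (@cvg_Rintegral01 _ _ (nbhs x) (nbhs_filter x)).
- by move=> t t01 e e0; exact: integrand_near.
- exact: integrand_continuous.
- by apply: filterS (near_ball_rV xb) => y yb; exact: integrand_continuous.
Qed.

End WithWeight.

Lemma param_int_derive w f (i : 'I_n) x : continuous w -> ball p r x ->
  diff_class 1 (ball p r) f ->
  is_derive x (delta_mx 0 i : 'rV[R]_n) (param_int w f)
    (param_int (fun t => w t * tau t i) ('D_(delta_mx 0 i) f) x).
Proof.
move=> cw xb cf.
have cf0 y : ball p r y -> {for y, continuous f}.
  by move=> yb; exact: diff_class_continuous cf yb.
have cdf y : ball p r y -> {for y, continuous ('D_(delta_mx 0 i) f)}.
  by case: cf => _ /(_ i)[_ [+ _]]; apply.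
have df y : ball p r y -> derivable f y (delta_mx 0 i).
  by move=> yb; exact: diff_class_derivable cf yb.
have cwt : continuous (fun t => w t * tau t i).
  by move=> t; apply: cvgM; [exact: cw|exact: tau_cont].
pose e : 'rV[R]_n := delta_mx 0 i.
pose D t y := (w t * tau t i) * 'D_e f (stretch p (tau t) y).
(* domination: as [0, 1] is compact, the derivative of the integrand is bounded
   near x uniformly in t *)
have [C [C0 HC]] : exists C : R, 0 <= C /\ \forall y \near x,
    `[0, 1] `<=` [set t | `|D t y| <= C].
  have K := integrand_continuous cwt xb cdf.
  have /compact_bounded : compact ((fun t => D t x) @` `[0, 1]).
    by apply: continuous_compact => //; exact: segment_compact.
  case=> M [_ /(_ (Num.max M 0 + 1))]; rewrite ltr_pwDr ?le_max ?lexx // => /(_ isT) HM.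
  exists (Num.max M 0 + 1 + 1); split.
    by rewrite addr_ge0 // addr_ge0 // le_max lexx orbT.
  have /compact_near_coveringP N := @segment_compact R 0 1.
  have : \forall y \near x, `[0, 1] `<=` [set t | `|D t x - D t y| < 1].
    apply: (N _ (nbhs x) (fun y t => `|D t x - D t y| < 1) (nbhs_filter x)) => t t01.
    exact: (integrand_near cwt t01 xb cdf ltr01).
  apply: filterS => y Hy t t01; rewrite /=.
  have := HM (D t x) (ex_intro2 _ _ t t01 erefl) => /= HM'.
  rewrite -[D t y](subrK (D t x)) addrC.
  apply: le_trans (ler_normD _ _) _; apply: lerD => //.
  by rewrite distrC; apply: ltW; exact: Hy.
have lx : (fun h : R => h *: e + x) @ (0 : R) --> x.
  rewrite -[X in _ --> X]add0r -(scale0r e); apply: cvgD; last exact: cvg_cst.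
  by apply: cvgZ; [exact: cvg_id|exact: cvg_cst].
have HB : nbhs x [set y | ball p r y /\ `[0, 1] `<=` [set t | `|D t y| <= C]].
  by apply: filterS2 (near_ball_rV xb) HC.
have [d /= d0 Hd] : \forall h \near (0 : R), ball p r (h *: e + x) /\
    `[0, 1] `<=` [set t | `|D t (h *: e + x)| <= C] := lx _ HB.
pose G (s t : R) := w t * f (stretch p (tau t) (s *: e + x)).
have sd s : `]- d, d[%classic s -> ball p r (s *: e + x) /\
    `[0, 1] `<=` [set t | `|D t (s *: e + x)| <= C].
  by rewrite /= in_itv /= -ltr_norml => sd; apply: Hd; rewrite /= sub0r normrN.
have GD s t : `]- d, d[%classic s -> `[0, 1]%classic t ->
    is_derive s (1 : R) (G ^~ t) (D t (s *: e + x)).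
  move=> /sd[sb _] t01; rewrite /D -mulrA.
  have := @is_derive_stretch f p (tau t) i x s.
  have sb' : ball p r (stretch p (tau t) (s *: e + x)).
    by apply: stretch_ball => //; exact: tau01.
  move=> /(_ (df _ sb')) H.
  exact: is_deriveZ.
have I0 : `]- d, d[%classic (0 : R) by rewrite /= in_itv /= oppr_lt0 d0.
have P1of2 s t : `]- d, d[%classic s -> `[0, 1]%classic t ->
    partial1of2 G s t = D t (s *: e + x).
  by move=> sI tI; rewrite partial1of2E; have [_] := GD _ _ sI tI.
have intG s : `]- d, d[%classic s -> mu.-integrable `[0, 1] (EFin \o G s).
  move=> /sd[sb _]; apply: continuous_compact_integrable.
    exact: segment_compact.
  exact: integrand_continuous.
have derG s t : `]- d, d[%classic s -> `[0, 1]%classic t -> derivable (G^~ t) s 1.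
  by move=> sI tI; have [] := GD _ _ sI tI.
have intC : mu.-integrable `[0, 1] (EFin \o (fun=> C)).
  apply: continuous_compact_integrable; first exact: segment_compact.
  by move=> y; exact: cst_continuous.
have ubC s t : `]- d, d[%classic s -> `[0, 1]%classic t ->
    `|partial1of2 G s t| <= C.
  by move=> sI tI; rewrite P1of2 //; exact: (sd _ sI).2.
have F1 := derivable_under_integral (mu := mu) (measurable_itv _) I0 intG derG
  (fun=> C0) intC ubC.
have F2 := differentiation_under_integral (mu := mu) (measurable_itv _) I0 intG derG
  (fun=> C0) intC ubC.
apply: DeriveDef.
  by apply/derivable1P.
have -> : 'D_e (param_int w f) x = 'D_1 (fun s : R => param_int w f (s *: e + x)) 0.
  rewrite /derive /=.
  have -> : (fun h : R => h^-1 *: (param_int w f ((h%:A + 0) *: e + x) -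
      param_int w f (0 *: e + x))) =
      (fun h : R => h^-1 *: (param_int w f (h *: e + x) - param_int w f x)).
    by apply/funext => h; rewrite addr0 scale0r add0r [h%:A]mulr1.
  by [].
rewrite -derive1E F2; apply: eq_Rintegral => t; rewrite inE => tI.
by rewrite P1of2 // scale0r add0r.
Qed.

End Stretch.

(** * Hadamard's lemma and the chain rule *)

Section Hadamard.
Context {R : realType} {n : nat}.
Local Notation mu := (@lebesgue_measure R).
Implicit Types (p x y : 'rV[R]_n) (f : 'rV[R]_n -> R).

Lemma param_int_diff_class p (r : R) (tau : R -> 'I_n -> R) k w f :
  (forall j, continuous (tau ^~ j)) ->
  (forall t, t \in `[0, 1] -> forall j, 0 <= tau t j <= 1) ->
  continuous w -> diff_class k (ball p r) f ->
  diff_class k (ball p r) (param_int p tau w f).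
Proof.
move=> tc t01; elim: k w f => [|k IH] w f cw Hf.
  split=> // x xb; apply: (param_int_continuous (r := r)) => // y yb.
  exact: diff_class_continuous Hf yb.
have Hf1 : diff_class 1 (ball p r) f by apply: diff_class_le Hf.
split=> [x xb|i].
  apply: (param_int_continuous (r := r)) => // y yb.
  exact: diff_class_continuous Hf yb.
have D x (xb : ball p r x) := param_int_derive tc t01 i cw xb Hf1.
split=> [x xb|]; first by have [] := D x xb.
have cwt : continuous (fun t => w t * tau t i).
  by move=> t; apply: cvgM; [exact: cw|exact: tc].
case: (Hf) => _ /(_ i)[_ dfi].
apply: diff_class_ext (IH _ _ cwt dfi); first exact: ball_open.
by move=> x xb; have [_ ->] := D x xb.
Qed.

(** Contraction factors on the j-th leg, which moves the j-th coordinate, of a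
    broken line from p to x. Along it only partial derivatives of f are ever
    integrated, so that no chain rule is needed. *)
Definition leg (j : nat) (t : R) (i : 'I_n) : R :=
  if (i < j)%N then 1 else if i == j :> nat then t else 0.

Lemma leg_continuous j i : continuous (fun t => leg j t i).
Proof.
rewrite /leg; case: (i < j)%N => t; first exact: cvg_cst.
by case: eqP => _; [exact: cvg_id|exact: cvg_cst].
Qed.

Lemma leg01 j t : t \in `[0, 1] -> forall i, 0 <= leg j t i <= 1.
Proof.
rewrite in_itv /= => /andP[t0 t1] i; rewrite /leg.
case: (i < j)%N; first by rewrite ler01 lexx.
by case: eqP; rewrite ?t0 ?t1 ?lexx ?ler01.
Qed.

Lemma leg_line p x (j : 'I_n) t :
  stretch p (leg j t) x =
  (t * (x 0 j - p 0 j)) *: delta_mx 0 j + stretch p (leg j 0) x.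
Proof.
apply/rowP => i; rewrite !mxE /leg eqxx /=; case: (ltngtP i j) => ij /=.
- by rewrite (_ : (i == j) = false) ?mulr0 ?add0r //; apply/negbTE/eqP => E; rewrite E ltnn in ij.
- by rewrite (_ : (i == j) = false) ?mulr0 ?add0r //; apply/negbTE/eqP => E; rewrite E ltnn in ij.
- have -> : i = j by exact: val_inj.
  by rewrite eqxx mulr1 mul0r addr0 addrC.
Qed.

Lemma leg_int p (r : R) f x (j : 'I_n) : diff_class 1 (ball p r) f -> ball p r x ->
  f (stretch p (leg j 1) x) - f (stretch p (leg j 0) x) =
  (x 0 j - p 0 j) * param_int p (leg j) (fun=> 1) ('D_(delta_mx 0 j) f) x.
Proof.
move=> Hf xb; pose d := x 0 j - p 0 j.
pose F (t : R) := f (stretch p (leg j t) x).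
pose f' (t : R) := d * 'D_(delta_mx 0 j) f (stretch p (leg j t) x).
have c1 : continuous (fun _ : R => 1 : R) by move=> t; exact: cvg_cst.
have cd : continuous (fun _ : R => d) by move=> t; exact: cvg_cst.
have cf y : ball p r y -> {for y, continuous f}.
  by move=> yb; exact: diff_class_continuous Hf yb.
have cdf y : ball p r y -> {for y, continuous ('D_(delta_mx 0 j) f)}.
  by case: Hf => _ /(_ j)[_ [+ _]]; apply.
have C1 := integrand_continuous (@leg_continuous j) (@leg01 j) c1 xb cdf.
have C2 := integrand_continuous (@leg_continuous j) (@leg01 j) cd xb cdf.
have DF (t : R) : t \in `[0, 1] -> is_derive t (1 : R) F (f' t).
  move=> t01; rewrite /F /f'; under eq_fun do rewrite leg_line.
  rewrite (leg_line p x j t); apply: is_derive_line_scaled.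
  rewrite -(leg_line p x j t).
  apply: diff_class_derivable Hf _; apply: stretch_ball => //; exact: leg01.
have CF (t : R) : t \in `[0, 1] -> {for t, continuous F}.
  move=> /DF[dF _]; apply: differentiable_continuous.
  exact/derivable1_diffP.
have sub (t : R) : t \in `]0, 1[ -> t \in `[0, 1] :> bool.
  by apply: subset_itv_oo_cc.
have E : (\int[mu]_(t in `[0%R, 1%R]) (f' t)%:E = (F 1)%:E - (F 0)%:E)%E.
  apply: continuous_FTC2 => //.
  - split.
    + by move=> t /sub/DF[].
    + apply: cvg_at_right_filter; apply: (CF 0).
      by rewrite in_itv /= lexx ler01.
    + apply: cvg_at_left_filter; apply: (CF 1).
      by rewrite in_itv /= lexx ler01.
  - by move=> t /sub/DF[_ <-]; rewrite derive1E.
transitivity (\int[mu]_(t in `[0, 1]) f' t).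
  by rewrite /Rintegral E.
rewrite /param_int -RintegralZl //.
  by apply: eq_Rintegral => t _; rewrite mul1r.
by apply: continuous_compact_integrable; [exact: segment_compact|exact: C1].
Qed.

Lemma stretch0 p x : stretch p (leg 0 0) x = p.
Proof. by apply/rowP => i; rewrite mxE /leg ltn0; case: ifP => _; rewrite mul0r addr0. Qed.

Lemma stretch1 p x : stretch p (leg n 0) x = x.
Proof. by apply/rowP => i; rewrite mxE /leg ltn_ord mul1r addrC subrK. Qed.

Lemma stretch_legS p x j : stretch p (leg j 1) x = stretch p (leg j.+1 0) x.
Proof.
suff H i : leg j 1 i = leg j.+1 0 i by apply/rowP => i; rewrite !mxE H.
rewrite /leg ltnS (leq_eqVlt i j) orbC.
by case: (i < j)%N => //=; case: (i == j :> nat) => //; rewrite if_same.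
Qed.

Definition hadamard_quot p f (j : 'I_n) : 'rV[R]_n -> R :=
  param_int p (leg j) (fun=> 1) ('D_(delta_mx 0 j) f).

Lemma hadamardE p (r : R) f x : diff_class 1 (ball p r) f -> ball p r x ->
  f x = f p + \sum_j (x 0 j - p 0 j) * hadamard_quot p f j x.
Proof.
move=> Hf xb; under eq_bigr => j _ do rewrite -(leg_int j Hf xb).
have -> : \sum_(j < n) (f (stretch p (leg j 1) x) - f (stretch p (leg j 0) x)) =
   \sum_(0 <= j < n) (f (stretch p (leg j.+1 0) x) - f (stretch p (leg j 0) x)).
  by rewrite big_mkord; apply: eq_bigr => j _; rewrite stretch_legS.
by rewrite telescope_sumr // stretch0 stretch1 addrC subrK.
Qed.

Lemma hadamard_diff_class p (r : R) f k j : diff_class k.+1 (ball p r) f ->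
  diff_class k (ball p r) (hadamard_quot p f j).
Proof.
move=> [_ /(_ j)[_ H]]; apply: param_int_diff_class H.
- by move=> i; exact: leg_continuous.
- by move=> t t01 i; exact: leg01.
- by move=> t; exact: cvg_cst.
Qed.

Lemma hadamard_center p f j : hadamard_quot p f j p = 'D_(delta_mx 0 j) f p.
Proof.
rewrite /hadamard_quot /param_int.
transitivity (\int[mu]_(t in `[0, 1]) ('D_(delta_mx 0 j) f p)).
  have sp (t : R) : stretch p (leg j t) p = p.
    by apply/rowP => i; rewrite mxE subrr mulr0 addr0.
  by apply: eq_Rintegral => t _; rewrite mul1r sp.
rewrite Rintegral_cst //= lebesgue_measure_itv /= lte_fin ltr01 /=.
by rewrite oppr0 addr0 mulr1.
Qed.

End Hadamard.

(** Hadamard's decomposition of f around F x turns the difference quotients of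
    f \o F into combinations, with continuous coefficients, of those of the
    components of F. *)
Lemma is_derive_chain {R : realType} {m n : nat} (F : 'rV[R]_m -> 'rV[R]_n)
    (f : 'rV[R]_n -> R) (V : set 'rV[R]_n) (x v : 'rV[R]_m) :
  open V -> V (F x) -> diff_class 1 V f ->
  {for x, continuous F} -> (forall j, derivable (fun y => F y 0 j) x v) ->
  is_derive x v (f \o F)
    (\sum_j 'D_v (fun y => F y 0 j) x * 'D_(delta_mx 0 j) f (F x)).
Proof.
move=> oV VFx Hf cF dF.
have [r /= r0 rV] : nbhs_ball (F x) V.
  by apply/nbhs_ballP; exact: open_nbhs_nbhs.
have Hr := diff_class_sub rV Hf.
pose q j := hadamard_quot (F x) f j.
have l0 : (fun h : R => h *: v + x) @ (0 : R) --> x.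
  rewrite -[X in _ --> X]add0r -(scale0r v); apply: cvgD; last exact: cvg_cst.
  by apply: cvgZ; [exact: cvg_id|exact: cvg_cst].
have lx : (fun h : R => h *: v + x) @ 0^' --> x.
  by apply: cvg_trans l0; apply: cvg_app; exact: cvg_within.
have lF := cvg_comp _ _ lx cF.
have L : (\sum_j (h^-1 *: (F (h *: v + x) 0 j - F x 0 j)) * q j (F (h *: v + x)))
    @[h --> 0^'] --> \sum_j 'D_v (fun y => F y 0 j) x * q j (F x).
  apply: cvg_big => [|j _]; first exact: add_continuous.
  apply: cvgM; first exact: dF.
  apply: (cvg_comp _ (q j) lF).
  have := hadamard_diff_class j Hr => /diff_class_continuous; apply.
  exact: ballxx.
have H : h^-1 *: ((f \o F) (h *: v + x) - (f \o F) x) @[h --> 0^'] -->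
    \sum_j 'D_v (fun y => F y 0 j) x * 'D_(delta_mx 0 j) f (F x).
  under eq_bigr do rewrite -hadamard_center.
  apply: cvg_trans L; apply: near_eq_cvg.
  have HB : nbhs (F x) (ball (F x) r) by apply/nbhs_ballP; exists r.
  have : \forall h \near 0^', ball (F x) r (F (h *: v + x)) := lF _ HB.
  apply: filterS => h hb; rewrite /= (hadamardE Hr hb) (addrC (f _)) addrK scaler_sumr.
  by apply: eq_bigr => j _; rewrite /q -mulrA.
apply: DeriveDef; first by apply/cvg_ex; eexists; exact: H.
exact: cvg_lim H.
Qed.

Lemma diff_class_comp {R : realType} {m n : nat} k (F : 'rV[R]_m -> 'rV[R]_n)
    (f : 'rV[R]_n -> R) (U : set 'rV[R]_m) (V : set 'rV[R]_n) :
  open U -> open V -> (forall x, U x -> V (F x)) ->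
  (forall j, diff_class k U (fun y => F y 0 j)) -> diff_class k V f ->
  diff_class k U (f \o F).
Proof.
move=> oU oV UV; elim: k f => [|k IH] f HF Hf.
  split=> // x Ux; apply: continuous_comp.
    by apply: (@cvg_rV _ _ _ (nbhs x) (nbhs_filter x)) => j; have [+ _] := HF j; apply.
  by apply: diff_class_continuous Hf _; exact: UV.
have cF x : U x -> {for x, continuous F}.
  by move=> Ux; apply: (@cvg_rV _ _ _ (nbhs x) (nbhs_filter x)) => j; have [+ _] := HF j; apply.
have D (i : 'I_m) x (Ux : U x) := is_derive_chain oV (UV x Ux) (diff_class_le (ltn0Sn k) Hf)
  (cF x Ux) (fun j => diff_class_derivable (i := i) (HF j) Ux).
split=> [x Ux|i].
  apply: continuous_comp; first exact: cF.
  by apply: diff_class_continuous Hf _; exact: UV.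
split=> [x Ux|]; first by have [] := D i x Ux.
have G : diff_class k U (fun x => \sum_j 'D_(delta_mx 0 i) (fun y => F y 0 j) x
    * ('D_(delta_mx 0 j) f \o F) x).
  apply: diff_class_sum => // j _; apply: diff_classM => //.
    by have [_ /(_ i)[_ +]] := HF j.
  apply: IH; last by have [_ /(_ j)[_ +]] := Hf.
  by move=> l; exact: diff_class_le (leqnSn k) (HF l).
by apply: diff_class_ext G => // x Ux; have [_ ->] := D i x Ux.
Qed.

Lemma diff_class_sqrt {R : realType} {n : nat} k (U : set 'rV[R]_n)
    (f : 'rV[R]_n -> R) : open U -> (forall x, U x -> 0 < f x) ->
  diff_class k U f -> diff_class k U (fun x => Num.sqrt (f x)).
Proof.
move=> oU f0; elim: k => [|k IH] Hf; have [cf df] := Hf.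
  split=> // x Ux; apply: continuous_comp; first exact: cf.
  exact: sqrt_continuous.
have D (i : 'I_n) x : U x -> is_derive x (delta_mx 0 i : 'rV[R]_n)
    (fun x => Num.sqrt (f x)) ((2 * Num.sqrt (f x))^-1 * 'D_(delta_mx 0 i) f x).
  move=> Ux; pose e : 'rV[R]_n := delta_mx 0 i; pose g (h : R) := f (h *: e + x).
  have g0 : g 0 = f x by rewrite /g scale0r add0r.
  have dg : is_derive (0 : R) (1 : R) g ('D_e f x).
    have H := @is_derive_line R n f x e 0; rewrite scale0r add0r in H.
    by apply: H; have [+ _] := df i; apply.
  have ds : is_derive (g 0) 1 Num.sqrt (2 * Num.sqrt (f x))^-1.
    by rewrite g0; apply: is_derive1_sqrt; exact: f0.
  have [d1 d2] := is_derive1_comp ds dg.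
  apply: DeriveDef; first by apply/derivable1P.
  rewrite -d2 /derive /=.
  have -> : (fun h : R => h^-1 *: (Num.sqrt (g (h%:A + 0)) - Num.sqrt (g 0))) =
      (fun h : R => h^-1 *: (Num.sqrt (f (h *: e + x)) - Num.sqrt (f x))).
    by apply/funext => h; rewrite addr0 g0 /g [h%:A]mulr1.
  by [].
split=> [x Ux|i].
  by apply: continuous_comp; [exact: cf|exact: sqrt_continuous].
split=> [x Ux|]; first by have [] := D i x Ux.
have H1 := IH (diff_class_le (leqnSn k) Hf).
have H2 := diff_classV oU _ (diff_classM oU (diff_class_cst k U 2) H1).
apply: diff_class_ext (diff_classM oU (H2 _) (df i).2) => //.
  by move=> x Ux; have [_ ->] := D i x Ux.
by move=> x Ux; rewrite mulf_neq0 // gt_eqF // sqrtr_gt0 f0.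
Qed.

(** * Germs of smooth functions on a manifold *)

Lemma open_preimI {S T : topologicalType} (F : S -> T) (V : set S) (U : set T) :
  open V -> open U -> (forall x, V x -> {for x, continuous F}) ->
  open (V `&` F @^-1` U).
Proof.
move=> oV oU cF; rewrite openE => x [Vx Ux].
apply: filterI; first exact: open_nbhs_nbhs.
exact: (cF x Vx U (open_nbhs_nbhs (conj oU Ux))).
Qed.

Section Charts.
Context {R : realType} {n : nat} {M : manifold R n}.
Implicit Types (c d : chart R M n) (p q : M) (f g : M -> R).

Definition smooth_in c p f : Prop :=
  exists U : set 'rV[R]_n, [/\ open U, U (c p), U `<=` c @` cdom c &
    smooth_on U (f \o cinv c)].

(** Charts of the maximal atlas; integrability of an almost complex structure
    provides such charts rather than charts of the given atlas. *)
Definition admissible c := forall d, @atlas R n M d -> compatible c d.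

Lemma atlas_admissible c : @atlas R n M c -> admissible c.
Proof. by move=> Ac d Ad; exact: atlas_compatible. Qed.

Lemma cimg_cinv c y : (c @` cdom c) y -> cdom c (cinv c y) /\ c (cinv c y) = y.
Proof. by move=> [x dx <-]; rewrite cmapK. Qed.

Lemma open_chart_image c (W : set M) : open W -> open (c @` (cdom c `&` W)).
Proof.
move=> oW; have -> : c @` (cdom c `&` W) = c @` cdom c `&` cinv c @^-1` W.
  apply/seteqP; split=> y.
    by move=> [x [dx Wx] <-]; split; [exists x|rewrite /= cmapK].
  by move=> [[x dx <-]]; rewrite /= cmapK // => Wx; exists x.
by apply: open_preimI => //; [exact: cimg_open|exact: cinv_continuous].
Qed.

Lemma smooth_in_change c d p f : smooth_transition d c -> cdom c p -> cdom d p ->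
  smooth_in c p f -> smooth_in d p f.
Proof.
move=> Tdc cp dp [U [oU Up UD sU]].
pose V := d @` (cdom d `&` cdom c); pose F y := c (cinv d y).
have oV : open V by apply: open_chart_image; exact: cdom_open.
have VF y : V y -> {for y, continuous F}.
  move=> [x [dx cx] <-]; apply: continuous_comp.
    by apply: cinv_continuous; exists x.
  by rewrite cmapK //; exact: cmap_continuous.
have oVF : open (V `&` F @^-1` U) by exact: open_preimI.
exists (V `&` F @^-1` U); split=> //.
- by split; [exists p|rewrite /= /F cmapK].
- by move=> y [[x [dx _] <-] _]; exists x.
move=> k; apply: (@diff_class_ext _ _ _ _ ((f \o cinv c) \o F)) => //.
  by move=> _ [[x [dx cx] <-] _]; rewrite /= /F cmapK // cmapK.
apply: (diff_class_comp (V := U)) => //; first by move=> y [].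
by move=> j; apply: diff_class_sub (Tdc j k) => y [].
Qed.

Lemma smooth_at_chart c p f : admissible c -> cdom c p ->
  smooth_at p f <-> smooth_in c p f.
Proof.
move=> ac cp; split=> [sf|sf d Ad dp].
  have [d Ad dp] := atlas_cover p.
  by apply: smooth_in_change (sf d Ad dp) => //; have [] := ac d Ad.
by apply: smooth_in_change sf => //; have [] := ac d Ad.
Qed.

Lemma chart_at p : exists2 c, admissible c & cdom c p.
Proof. by have [c Ac cp] := atlas_cover p; exists c => //; exact: atlas_admissible. Qed.

Lemma near_cdom c p : cdom c p -> \forall q \near p, cdom c q.
Proof. by move=> cp; apply: open_nbhs_nbhs; split=> //; exact: cdom_open. Qed.

Lemma smooth_at_near p f : smooth_at p f -> \forall q \near p, smooth_at q f.
Proof.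
have [c ac cp] := chart_at p.
move=> /(smooth_at_chart f ac cp)[U [oU Up UD sU]].
have : nbhs p (c @^-1` U).
  exact: (cmap_continuous cp (open_nbhs_nbhs (conj oU Up))).
apply: filterS2 (near_cdom cp) => q cq Uq.
by apply/(smooth_at_chart f ac cq); exists U.
Qed.

Lemma smooth_at_near_eq p f g : (\forall q \near p, f q = g q) ->
  smooth_at p f -> smooth_at p g.
Proof.
have [c ac cp] := chart_at p.
rewrite /= => fg /(smooth_at_chart f ac cp)[U [oU Up UD sU]].
have fg' : nbhs p [set q | f q = g q] by [].
move: fg'; rewrite nbhsE => -[W [oW Wp] Wfg].
apply/(smooth_at_chart g ac cp).
have oUW : open (U `&` cinv c @^-1` W).
  by apply: open_preimI => // y /UD; exact: cinv_continuous.
exists (U `&` cinv c @^-1` W); split=> //.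
- by split=> //; rewrite /= cmapK.
- by move=> y [/UD].
move=> k; apply: diff_class_ext (diff_class_sub _ (sU k)) => //.
by move=> y [_ /Wfg].
Qed.

(** Read in a chart, on the open set where (f, g) takes values in the domain V of
    the operation, this is the hypothesis on classes of differentiability. *)
Lemma smooth_at_op2 (V : set (R * R)) (op : R -> R -> R) p f g : open V ->
  (forall (m : nat) k (U : set 'rV[R]_m) (u v : 'rV[R]_m -> R), open U ->
     (forall x, U x -> V (u x, v x)) ->
     diff_class k U u -> diff_class k U v ->
     diff_class k U (fun x => op (u x) (v x))) ->
  V (f p, g p) -> smooth_at p f -> smooth_at p g ->
  smooth_at p (fun q => op (f q) (g q)).
Proof.
move=> oV Hop Vp; have [c ac cp] := chart_at p.
move=> /(smooth_at_chart f ac cp)[U [oU Up UD sU]].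
move=> /(smooth_at_chart g ac cp)[U' [oU' Up' UD' sU']].
apply/(smooth_at_chart _ ac cp).
pose F y := (f (cinv c y), g (cinv c y)).
have oUU : open (U `&` U') by exact: openI.
have oW : open ((U `&` U') `&` F @^-1` V).
  apply: open_preimI => // y [Uy Uy'].
  exact: (cvg_pair (diff_class_continuous (sU 0) Uy)
                   (diff_class_continuous (sU' 0) Uy')).
exists ((U `&` U') `&` F @^-1` V); split=> //.
- by split=> //; rewrite /= /F cmapK.
- by move=> y [[/UD]].
move=> k; apply: (Hop n k _ (f \o cinv c) (g \o cinv c)) => //.
- by move=> y [].
- by apply: diff_class_sub (sU k) => y [[]].
- by apply: diff_class_sub (sU' k) => y [[]].
Qed.

Lemma smooth_at_cst p (a : R) : smooth_at p (fun=> a).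
Proof.
move=> c Ac cp; exists (c @` cdom c); split=> //; first exact: cimg_open.
by move=> k; exact: diff_class_cst.
Qed.

Lemma smooth_atD p f g : smooth_at p f -> smooth_at p g ->
  smooth_at p (fun q => f q + g q).
Proof.
apply: (@smooth_at_op2 setT +%R) => //; first exact: openT.
by move=> m k U u v oU _; exact: diff_classD.
Qed.

Lemma smooth_atM p f g : smooth_at p f -> smooth_at p g ->
  smooth_at p (fun q => f q * g q).
Proof.
apply: (@smooth_at_op2 setT *%R) => //; first exact: openT.
by move=> m k U u v oU _; exact: diff_classM.
Qed.

Lemma smooth_atN p f : smooth_at p f -> smooth_at p (fun q => - f q).
Proof.
move=> sf; have := smooth_atM (smooth_at_cst (-1)) sf.
by under eq_fun do rewrite mulN1r.
Qed.

Lemma smooth_atB p f g : smooth_at p f -> smooth_at p g ->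
  smooth_at p (fun q => f q - g q).
Proof. by move=> sf sg; apply: smooth_atD => //; exact: smooth_atN. Qed.

Lemma smooth_at_sum p (I : Type) (r : seq I) (P : pred I) (F : I -> M -> R) :
  (forall i, P i -> smooth_at p (F i)) ->
  smooth_at p (fun q => \sum_(i <- r | P i) F i q).
Proof.
move=> HF; elim: r => [|i r IH].
  by under eq_fun do rewrite big_nil; exact: smooth_at_cst.
have [Pi|nPi] := boolP (P i).
  by under eq_fun do rewrite big_cons Pi; apply: smooth_atD (HF _ Pi) IH.
by under eq_fun do rewrite big_cons (negbTE nPi).
Qed.

Lemma smooth_at_prod p (I : Type) (r : seq I) (P : pred I) (F : I -> M -> R) :
  (forall i, P i -> smooth_at p (F i)) ->
  smooth_at p (fun q => \prod_(i <- r | P i) F i q).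
Proof.
move=> HF; elim: r => [|i r IH].
  by under eq_fun do rewrite big_nil; exact: smooth_at_cst.
have [Pi|nPi] := boolP (P i).
  by under eq_fun do rewrite big_cons Pi; apply: smooth_atM (HF _ Pi) IH.
by under eq_fun do rewrite big_cons (negbTE nPi).
Qed.

Lemma smooth_atV p f : f p != 0 -> smooth_at p f -> smooth_at p (fun q => (f q)^-1).
Proof.
move=> f0 sf.
apply: (@smooth_at_op2 [set z : R * R | z.1 != 0] (fun a _ => a^-1) p f f) => //.
  rewrite (_ : [set z | _] = fst @^-1` [set x : R | x != 0]) //.
  apply: open_comp; last exact: open_neq.
  by move=> z _; exact: cvg_fst.
by move=> m k U u v oU u0 cu _; exact: diff_classV.
Qed.

Lemma smooth_at_sqrt p f : 0 < f p -> smooth_at p f ->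
  smooth_at p (fun q => Num.sqrt (f q)).
Proof.
move=> f0 sf.
apply: (@smooth_at_op2 [set z : R * R | 0 < z.1] (fun a _ => Num.sqrt a) p f f) => //.
  rewrite (_ : [set z | _] = fst @^-1` [set x : R | 0 < x]) //.
  apply: open_comp; last exact: open_gt.
  by move=> z _; exact: cvg_fst.
by move=> m k U u v oU u0 cu _; exact: diff_class_sqrt.
Qed.

Lemma smooth_at_det p m (A : M -> 'M[R]_m) :
  (forall i j, smooth_at p (fun q => A q i j)) -> smooth_at p (fun q => \det (A q)).
Proof.
move=> sA; apply: smooth_at_sum => s _; apply: smooth_atM.
  exact: smooth_at_cst.
by apply: smooth_at_prod => i _; exact: sA.
Qed.

Lemma smooth_at_invmx p m (A : M -> 'M[R]_m) i j :
  (\forall q \near p, A q \in unitmx) ->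
  (forall i j, smooth_at p (fun q => A q i j)) ->
  smooth_at p (fun q => invmx (A q) i j).
Proof.
move=> uA sA.
apply: (@smooth_at_near_eq _ (fun q =>
    (\det (A q))^-1 * ((-1) ^+ (j + i) * \det (row' j (col' i (A q)))))).
  by apply: filterS uA => q uq; rewrite /invmx uq !mxE.
apply: smooth_atM; last apply: smooth_atM.
- apply: smooth_atV; last exact: smooth_at_det.
  by have := nbhs_singleton uA; rewrite /= unitmxE unitfE.
- exact: smooth_at_cst.
- apply: smooth_at_det => a b.
  by under eq_fun do rewrite !mxE; exact: sA.
Qed.

Lemma smooth_at_coord c p a : admissible c -> cdom c p ->
  smooth_at p (fun q => c q 0 a).
Proof.
move=> ac cp; apply/(smooth_at_chart _ ac cp).
exists (c @` cdom c); split=> //; first exact: cimg_open.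
move=> k; apply: diff_class_ext (diff_class_coord k _ a); first exact: cimg_open.
by move=> y /cimg_cinv[_]; rewrite /= => ->.
Qed.

End Charts.

(** * Tangent vectors as derivations *)

#[global] Arguments tangent_val {R n M p} _ _ : simpl never.

Section Tangent.
Context {R : realType} {n : nat} {M : manifold R n}.
Implicit Types (c d : chart R M n) (p q : M) (f g : M -> R) (X Y : vfield M).

Lemma tangent_derivation p (u : tangent p) : derivation p u.
Proof. by apply/asboolP; exact: (valP u). Qed.

Lemma tangent_ext p (u v : tangent p) :
  (forall f, smooth_at p f -> u f = v f) -> u = v.
Proof.
move=> uv; apply/val_inj/funext => f.
have [sf|nsf] := pselect (smooth_at p f); first exact: uv.
have [u0 _] := tangent_derivation u; have [v0 _] := tangent_derivation v.
by rewrite /= u0 // v0.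
Qed.

Lemma tangentDE p (u v : tangent p) f : (u + v) f = u f + v f.
Proof. by []. Qed.

Lemma tangentZE p (a : R) (u : tangent p) f : (a *: u) f = a * u f.
Proof. by []. Qed.

Lemma tangentNE p (u : tangent p) f : (- u) f = - u f.
Proof. by []. Qed.

Lemma tangent0E p f : (0 : tangent p) f = 0.
Proof. by []. Qed.

Lemma tangent_sumE p (I : Type) (r : seq I) (P : pred I) (u : I -> tangent p) f :
  (\sum_(i <- r | P i) u i) f = \sum_(i <- r | P i) u i f.
Proof. exact: (big_morph (fun u : tangent p => u f)). Qed.

Lemma der_near p (u : tangent p) f g : smooth_at p f ->
  (\forall q \near p, f q = g q) -> u f = u g.
Proof.
move=> sf fg; have [_ H] := tangent_derivation u.
by have [+ _ _] := H f g sf (smooth_at_near_eq fg sf); apply.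
Qed.

Lemma derM p (u : tangent p) f g : smooth_at p f -> smooth_at p g ->
  u (fun q => f q * g q) = u f * g p + f p * u g.
Proof. by move=> sf sg; have [_ /(_ f g sf sg)[]] := tangent_derivation u. Qed.

Lemma derD p (u : tangent p) f g : smooth_at p f -> smooth_at p g ->
  u (fun q => f q + g q) = u f + u g.
Proof.
move=> sf sg; have [_ /(_ f g sf sg)[_ /(_ 1) + _]] := tangent_derivation u.
by rewrite mul1r; under eq_fun do rewrite mul1r.
Qed.

Lemma der_cst p (u : tangent p) (a : R) : u (fun=> a) = 0.
Proof.
have s1 := @smooth_at_cst R n M p 1.
have u1 : u (fun=> 1) = 0.
  have := derM u s1 s1; rewrite !mulr1 mul1r => /eqP.
  by rewrite -[X in X == _]addr0 (inj_eq (addrI _)) eq_sym => /eqP.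
have [_ /(_ _ _ s1 s1)[_ /(_ (a - 1)) + _]] := tangent_derivation u.
by rewrite u1 mulr0 addr0 mulr1 subrK.
Qed.

Lemma derZ p (u : tangent p) (a : R) f : smooth_at p f ->
  u (fun q => a * f q) = a * u f.
Proof.
move=> sf; rewrite (derM u (@smooth_at_cst R n M p a) sf).
by rewrite der_cst mul0r add0r.
Qed.

Lemma derN p (u : tangent p) f : smooth_at p f -> u (fun q => - f q) = - u f.
Proof.
by move=> sf; rewrite -mulN1r -derZ //; under [in RHS]eq_fun do rewrite mulN1r.
Qed.

Lemma derB p (u : tangent p) f g : smooth_at p f -> smooth_at p g ->
  u (fun q => f q - g q) = u f - u g.
Proof.
by move=> sf sg; rewrite (derD u sf (smooth_atN sg)) derN.
Qed.

Lemma der_sum p (u : tangent p) (I : Type) (r : seq I) (F : I -> M -> R) :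
  (forall i, smooth_at p (F i)) ->
  u (fun q => \sum_(i <- r) F i q) = \sum_(i <- r) u (F i).
Proof.
move=> sF; elim: r => [|i r IH].
  by under eq_fun do rewrite big_nil; rewrite big_nil der_cst.
under eq_fun do rewrite big_cons; rewrite big_cons -IH derD //.
by apply: smooth_at_sum => j _.
Qed.

Lemma tangent_ofE p (D : (M -> R) -> R) f :
  (forall f g, smooth_at p f -> smooth_at p g ->
    [/\ (\forall q \near p, f q = g q) -> D f = D g,
        forall a : R, D (fun q => a * f q + g q) = a * D f + D g &
        D (fun q => f q * g q) = D f * g p + f p * D g]) ->
  smooth_at p f -> tangent_of p D f = D f.
Proof.
move=> HD sf; pose D' (f : M -> R) := if `[< smooth_at p f >] then D f else 0.
have D'E h : smooth_at p h -> D' h = D h by move=> sh; rewrite /D' asboolT.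
have dD : D' \in derivations p.
  apply/asboolP; split=> [h nsh|h k sh sk]; first by rewrite /D' asboolF.
  have [D1 D2 D3] := HD h k sh sk; split.
  - by move=> hk; rewrite !D'E // D1.
  - move=> a; rewrite !D'E //; apply: smooth_atD => //.
    by apply: smooth_atM => //; exact: smooth_at_cst.
  - by rewrite !D'E //; exact: smooth_atM.
by rewrite /tangent_of -/D' -[tangent_val _]/(val _) val_insubd dD D'E.
Qed.

Lemma smooth_vf_near p X Y : (\forall q \near p, X q = Y q) ->
  smooth_vf_at p X -> smooth_vf_at p Y.
Proof.
move=> XY sX f sf; apply: smooth_at_near_eq (sX f sf).
by apply: filterS XY => q ->.
Qed.

Lemma smooth_vfD p X Y : smooth_vf_at p X -> smooth_vf_at p Y ->
  smooth_vf_at p (fun q => X q + Y q).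
Proof. by move=> sX sY f sf; apply: smooth_atD; [exact: sX|exact: sY]. Qed.

Lemma smooth_vfZ p f X : smooth_at p f -> smooth_vf_at p X ->
  smooth_vf_at p (fun q => f q *: X q).
Proof. by move=> sf sX g sg; apply: smooth_atM => //; exact: sX. Qed.

Lemma smooth_vfN p X : smooth_vf_at p X -> smooth_vf_at p (fun q => - X q).
Proof. by move=> sX f sf; apply: smooth_atN; exact: sX. Qed.

Lemma smooth_vfB p X Y : smooth_vf_at p X -> smooth_vf_at p Y ->
  smooth_vf_at p (fun q => X q - Y q).
Proof. by move=> sX sY; apply: smooth_vfD => //; exact: smooth_vfN. Qed.

Lemma smooth_vf0 p : smooth_vf_at p (fun q => 0 : tangent q).
Proof. by move=> f _; exact: smooth_at_cst. Qed.

Lemma smooth_vf_sum p (I : Type) (r : seq I) (F : I -> vfield M) :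
  (forall i, smooth_vf_at p (F i)) ->
  smooth_vf_at p (fun q => \sum_(i <- r) F i q).
Proof.
move=> sF f sf; under eq_fun do rewrite tangent_sumE.
by apply: smooth_at_sum => i _; exact: sF.
Qed.

(** * Coordinate vector fields *)

Definition dcoord c (a : 'I_n) : vfield M :=
  fun q => tangent_of q (fun f => 'D_(delta_mx 0 a) (f \o cinv c) (c q)).

Section InChart.
Variable c : chart R M n.
Hypothesis ac : admissible c.

Lemma dcoordE q a f : cdom c q -> smooth_at q f ->
  dcoord c a q f = 'D_(delta_mx 0 a) (f \o cinv c) (c q).
Proof.
move=> cq sf; apply: tangent_ofE sf => {}f g.
move=> /(smooth_at_chart f ac cq)[U [oU Uq UD sU]].
move=> /(smooth_at_chart g ac cq)[V [oV Vq VD sV]].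
have df := diff_class_derivable (i := a) (sU 1) Uq.
have dg := diff_class_derivable (i := a) (sV 1) Vq.
split.
- move=> fg; apply: near_eq_derive.
  have Iq : (c @` cdom c) (c q) by exists q.
  have H : cinv c @ c q --> cinv c (c q) := cinv_continuous Iq.
  by rewrite cmapK // in H; exact: (H _ fg).
- move=> b; rewrite -[LHS]/('D_(delta_mx 0 a) (b *: (f \o cinv c) + (g \o cinv c)) (c q)).
  by rewrite (deriveD (derivableZ (k := b) df) dg) (deriveZ b df).
- rewrite -[LHS]/('D_(delta_mx 0 a) ((f \o cinv c) * (g \o cinv c)) (c q)).
  rewrite (deriveM df dg) addrC; congr (_ + _); last first.
    by congr (_ * _); exact: (congr1 f (cmapK cq)).
  rewrite [LHS]mulrC; congr (_ * _); exact: (congr1 g (cmapK cq)).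
Qed.

Lemma smooth_dcoord q a : cdom c q -> smooth_vf_at q (dcoord c a).
Proof.
move=> cq f sf.
apply: (@smooth_at_near_eq _ _ _ _
  (fun q => 'D_(delta_mx 0 a) (f \o cinv c) (c q))).
  by apply: filterS2 (smooth_at_near sf) (near_cdom cq) => r sr cr; rewrite dcoordE.
move: sf => /(smooth_at_chart f ac cq)[U [oU Uq UD sU]].
apply/(smooth_at_chart _ ac cq); exists U; split=> // k.
have [_ /(_ a)[_ H]] := sU k.+1.
apply: diff_class_ext H => // y /UD/cimg_cinv[_ /=].
by move=> ->.
Qed.

Lemma dcoord_coord q a b : cdom c q ->
  dcoord c a q (fun r => c r 0 b) = (a == b)%:R.
Proof.
move=> cq; rewrite dcoordE //; last exact: smooth_at_coord.
have -> : (a == b)%:R = (delta_mx 0 a : 'rV[R]_n) 0 b by rewrite mxE eqxx eq_sym.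
have [_ <-] := is_derive_coord b (c q) (delta_mx 0 a).
apply: near_eq_derive.
have oI : open (c @` cdom c) by exact: cimg_open.
have Iq : (c @` cdom c) (c q) by exists q.
by apply: filterS (open_nbhs_nbhs (conj oI Iq)) => y /cimg_cinv[_ /=] ->.
Qed.

(** Hadamard's lemma writes a smooth function, up to a constant, as a
    combination of products of two smooth functions, one of which vanishes at
    the given point; a derivation is therefore determined by the values it
    takes on the coordinates. *)
Lemma tangent_coordE q (u : tangent q) : cdom c q ->
  u = \sum_a u (fun r => c r 0 a) *: dcoord c a q.
Proof.
move=> cq; apply: tangent_ext => f sf; rewrite tangent_sumE.
under eq_bigr do rewrite tangentZE dcoordE //.
move: sf => /(smooth_at_chart f ac cq)[U [oU Uq UD sU]].
have [r /= r0 rU] : nbhs_ball (c q) U.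
  by apply/nbhs_ballP; exact: open_nbhs_nbhs.
have Hr k := diff_class_sub rU (sU k).
pose G a (s : M) := hadamard_quot (c q) (f \o cinv c) a (c s).
pose x a (s : M) := c s 0 a.
have sG a : smooth_at q (G a).
  apply/(smooth_at_chart _ ac cq); exists (ball (c q) r); split.
  - exact: ball_open.
  - exact: ballxx.
  - by move=> y /rU/UD.
  - move=> k; apply: diff_class_ext (hadamard_diff_class a (Hr k.+1)).
      exact: ball_open.
    by move=> y /rU/UD/cimg_cinv[_]; rewrite /= /G => ->.
have sx a : smooth_at q (x a) by exact: smooth_at_coord.
have E : \forall s \near q, f s = f q + \sum_a (x a s - x a q) * G a s.
  have : nbhs q (c @^-1` ball (c q) r).
    by apply: (cmap_continuous cq); apply/nbhs_ballP; exists r.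
  apply: filterS2 (near_cdom cq) => s cs bs.
  by have := hadamardE (Hr 1) bs; rewrite /= !cmapK.
have sxx a : smooth_at q (fun s => x a s - x a q).
  by apply: smooth_atB => //; exact: smooth_at_cst.
have sP a : smooth_at q (fun s => (x a s - x a q) * G a s) by exact: smooth_atM.
have sf : smooth_at q f by apply/(smooth_at_chart f ac cq); exists U.
rewrite (der_near u sf E) derD; [|exact: smooth_at_cst|exact: smooth_at_sum].
rewrite der_cst add0r der_sum //; apply: eq_bigr => a _.
rewrite derM // subrr mul0r addr0 derB //; last exact: smooth_at_cst.
by rewrite der_cst subr0 /G hadamard_center.
Qed.

Lemma tangent_coord_ext q (u v : tangent q) : cdom c q ->
  (forall a, u (fun r => c r 0 a) = v (fun r => c r 0 a)) -> u = v.
Proof.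
move=> cq uv; rewrite (tangent_coordE u cq) (tangent_coordE v cq).
by apply: eq_bigr => a _; rewrite uv.
Qed.

End InChart.

(** Constant coefficients in the coordinate frame of a chart. This provides the
    extensions that the definition of the exterior derivative quantifies over. *)
Lemma vf_extension p (u : tangent p) : exists2 X, smooth_vf_at p X & X p = u.
Proof.
have [c ac cp] := chart_at p.
exists (fun q => \sum_a u (fun r => c r 0 a) *: dcoord c a q).
  apply: smooth_vf_sum => a; apply: smooth_vfZ; first exact: smooth_at_cst.
  exact: smooth_dcoord.
by rewrite -tangent_coordE.
Qed.

End Tangent.

(** * Differentials of smooth maps *)

Section Differential.
Context {R : realType} {m n : nat} {N : manifold R n} {M : manifold R m}.
Variable F : N -> M.
Hypothesis sF : smooth_map F.

Lemma differentialE p (u : tangent p) f : smooth_at (F p) f ->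
  differential F u f = u (f \o F).
Proof.
have [cF HF] := sF.
apply: tangent_ofE => {}f g sf sg; have sf' := HF _ _ sf; have sg' := HF _ _ sg.
split.
- by move=> fg; apply: der_near => //; exact: (cF p _ fg).
- move=> a; rewrite -[LHS]/(u (fun q => a * (f \o F) q + (g \o F) q)).
  rewrite derD ?derZ //; apply: smooth_atM => //; exact: smooth_at_cst.
- exact: derM.
Qed.

Lemma differential_linear p : linear (@differential R m n N M F p).
Proof.
move=> a u v; apply: tangent_ext => f sf.
by rewrite differentialE // !(tangentDE, tangentZE) !differentialE.
Qed.

Lemma differentialD p (u v : tangent p) :
  differential F (u + v) = differential F u + differential F v.
Proof. by have := differential_linear 1 u v; rewrite !scale1r. Qed.

Lemma differential0 p : differential F (0 : tangent p) = 0.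
Proof. by apply: tangent_ext => f sf; rewrite differentialE. Qed.

Lemma differentialZ p (a : R) (u : tangent p) :
  differential F (a *: u) = a *: differential F u.
Proof. by have := differential_linear a u 0; rewrite differential0 !addr0. Qed.

Lemma differentialN p (u : tangent p) : differential F (- u) = - differential F u.
Proof. by rewrite -scaleN1r differentialZ scaleN1r. Qed.

End Differential.

Lemma smooth_map_id {R : realType} {n : nat} (M : manifold R n) : smooth_map (@id M).
Proof. by split=> // p; exact: cvg_id. Qed.

Lemma differential_id {R : realType} {n : nat} {M : manifold R n} (p : M)
  (u : tangent p) : differential id u = u.
Proof.
by apply: tangent_ext => f sf; rewrite differentialE //; exact: smooth_map_id.
Qed.

(** * The Lie bracket *)

Section Lie.
Context {R : realType} {n : nat} {M : manifold R n}.
Implicit Types (p q : M) (f g : M -> R) (X Y : vfield M).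

Lemma der_near_vf p f g X : smooth_at p f -> (\forall q \near p, f q = g q) ->
  \forall q \near p, X q f = X q g.
Proof.
move=> sf fg; have fg2 : \forall q \near p, \forall r \near q, f r = g r.
  exact: (nbhs_interior fg).
by apply: filterS2 (smooth_at_near sf) fg2 => q sq; exact: der_near.
Qed.

Lemma lieE p X Y f : smooth_vf_at p X -> smooth_vf_at p Y -> smooth_at p f ->
  lie X Y p f = X p (fun q => Y q f) - Y p (fun q => X q f).
Proof.
move=> sX sY; apply: tangent_ofE => {}f g sf sg.
have near_fg : \forall q \near p, smooth_at q f /\ smooth_at q g.
  by apply: filterI; exact: smooth_at_near.
split.
- move=> fg; rewrite (der_near (X p) (sY f sf) (der_near_vf Y sf fg)).
  by rewrite (der_near (Y p) (sX f sf) (der_near_vf X sf fg)).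
- move=> a.
  have D (u : tangent p) (Z : vfield M) : smooth_vf_at p Z ->
      u (fun q => Z q (fun r => a * f r + g r)) =
      a * u (fun q => Z q f) + u (fun q => Z q g).
    move=> sZ; have s1 := smooth_atM (@smooth_at_cst _ _ _ p a) (sZ f sf).
    rewrite -(derZ u a (sZ f sf)) -(derD u s1 (sZ g sg)).
    apply/esym/der_near; first by apply: smooth_atD => //; exact: sZ.
    apply: filterS near_fg => q [sfq sgq].
    by rewrite derD ?derZ //; apply: smooth_atM => //; exact: smooth_at_cst.
  by rewrite !D //; ring.
- have D (u : tangent p) (Z : vfield M) : smooth_vf_at p Z ->
      u (fun q => Z q (fun r => f r * g r)) =
      u (fun q => Z q f) * g p + Z p f * u g + (u f * Z p g + f p * u (fun q => Z q g)).
    move=> sZ; have sZf := sZ f sf; have sZg := sZ g sg.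
    have s1 := smooth_atM sZf sg; have s2 := smooth_atM sf sZg.
    rewrite -derM // -derM // -derD //.
    apply/esym/der_near; first exact: smooth_atD.
    by apply: filterS near_fg => q [sfq sgq]; rewrite derM.
  by rewrite !D //; ring.
Qed.

Lemma lie_anti p X Y : smooth_vf_at p X -> smooth_vf_at p Y ->
  lie X Y p = - lie Y X p.
Proof.
by move=> sX sY; apply: tangent_ext => f sf; rewrite tangentNE !lieE // opprB.
Qed.

Lemma lieDl p X X' Y : smooth_vf_at p X -> smooth_vf_at p X' -> smooth_vf_at p Y ->
  lie (fun q => X q + X' q) Y p = lie X Y p + lie X' Y p.
Proof.
move=> sX sX' sY; have sD := smooth_vfD sX sX'.
apply: tangent_ext => f sf; rewrite tangentDE !lieE // tangentDE.
rewrite -[Y p (fun q => (X q + X' q) f)]/(Y p (fun q => X q f + X' q f)).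
rewrite derD; [by ring|exact: sX|exact: sX'].
Qed.

Lemma lieZl p f X Y : smooth_at p f -> smooth_vf_at p X -> smooth_vf_at p Y ->
  lie (fun q => f q *: X q) Y p = f p *: lie X Y p - Y p f *: X p.
Proof.
move=> sf sX sY; have sZ := smooth_vfZ sf sX.
apply: tangent_ext => g sg.
rewrite tangentDE tangentNE !tangentZE !lieE // tangentZE.
rewrite -[Y p (fun q => (f q *: X q) g)]/(Y p (fun q => f q * X q g)).
by rewrite derM; [ring|exact: sf|exact: sX].
Qed.

End Lie.

(** * Calculus along a smooth map *)

Section Along.
Context {R : realType} {m n : nat} {N : manifold R n} {M : manifold R m}.
Variable F : N -> M.
Hypothesis sF : smooth_map F.
Implicit Types (p : N) (X Y : vfield N).

(** The image of a field under F need not extend to a field of the target; written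
    in this way, it can still be differentiated and bracketed. *)
Definition along p X (I : finType) (c : I -> N -> R) (A : I -> vfield M) : Prop :=
  [/\ smooth_vf_at p X, forall i, smooth_at p (c i),
      forall i, smooth_vf_at (F p) (A i) &
      \forall q \near p, differential F (X q) = \sum_i c i q *: A i (F q)].

Lemma smooth_at_comp p f : smooth_at (F p) f -> smooth_at p (f \o F).
Proof. by case: sF => _; apply. Qed.

Lemma near_map p (P : M -> Prop) :
  (\forall r \near F p, P r) -> \forall q \near p, P (F q).
Proof. by have [cF _] := sF; exact: (cF p). Qed.

Lemma along_frame (c : chart R M m) p X : admissible c -> cdom c (F p) ->
  smooth_vf_at p X ->
  along p X (fun a q => X q (fun r => c (F r) 0 a)) (dcoord c).
Proof.
move=> ac cp sX; split=> //.
- by move=> a; apply: sX; apply: (@smooth_at_comp p (fun r => c r 0 a)); exact: smooth_at_coord.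
- by move=> a; exact: smooth_dcoord.
- apply: filterS (near_map (near_cdom cp)) => q cq.
  rewrite (tangent_coordE ac (differential F (X q)) cq); apply: eq_bigr => a _.
  by rewrite differentialE //; exact: smooth_at_coord.
Qed.

Lemma der_along p X Y (I J : finType) c A d B f :
  along p X (I := I) c A -> along p Y (I := J) d B -> smooth_at (F p) f ->
  X p (fun q => Y q (f \o F)) =
  \sum_j X p (d j) * B j (F p) f +
  \sum_i \sum_j c i p * d j p * A i (F p) (fun r => B j r f).
Proof.
move=> [sX sc sA XA] [sY sd sB YB] sf.
have sBf j : smooth_at p ((fun r => B j r f) \o F).
  by apply: smooth_at_comp; exact: sB.
rewrite (der_near (X p) (g := fun q => \sum_j d j q * B j (F q) f)); first last.
- apply: filterS2 YB (near_map (smooth_at_near sf)) => q YBq sfq.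
  by rewrite -differentialE // YBq tangent_sumE.
- by apply: sY; exact: smooth_at_comp.
rewrite der_sum => [|j]; last by apply: smooth_atM => //; exact: (sBf j).
rewrite exchange_big /= -big_split /=; apply: eq_bigr => j _.
rewrite (derM _ (sd j) (sBf j)) /=; congr (_ + _).
rewrite -differentialE //; last exact: sB.
rewrite (nbhs_singleton XA) tangent_sumE mulr_sumr; apply: eq_bigr => i _.
by rewrite tangentZE; ring.
Qed.

(** In the commutator of the two derivations of f \o F, the terms of second order
    in f recombine into the brackets of the target fields. *)
Lemma lie_along p X Y (I J : finType) c A d B :
  along p X (I := I) c A -> along p Y (I := J) d B ->
  differential F (lie X Y p) =
  \sum_j X p (d j) *: B j (F p) - \sum_i Y p (c i) *: A i (F p)
  + \sum_i \sum_j (c i p * d j p) *: lie (A i) (B j) (F p).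
Proof.
move=> HX HY; have [sX sc sA XA] := HX; have [sY sd sB YB] := HY.
apply: tangent_ext => f sf; rewrite differentialE // lieE //; last exact: smooth_at_comp.
rewrite (der_along HX HY sf) (der_along HY HX sf).
rewrite !tangentDE tangentNE !tangent_sumE opprD addrACA; congr (_ + _).
rewrite [X in _ - X]exchange_big /= -sumrN -big_split /=; apply: eq_bigr => i _.
rewrite tangent_sumE -sumrN -big_split /=; apply: eq_bigr => j _.
rewrite -[RHS]/(c i p * d j p * lie (A i) (B j) (F p) f) lieE //; ring.
Qed.

(** 2 da(X,Y), before the choice of extensions is forgotten. *)
Definition cartan {k : nat} {P : manifold R k} (a : covector_field P)
    (X Y : vfield P) (p : P) : R :=
  X p (fun q => a q (Y q)) - Y p (fun q => a q (X q)) - a p (lie X Y p).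

Definition pullback (a : covector_field M) : covector_field N :=
  fun q u => a (F q) (differential F u).

Section OneForm.
Variable a : covector_field M.
Arguments a : clear implicits.
Hypothesis fa : one_form a.

Lemma one_formD r (u v : tangent r) : a r (u + v) = a r u + a r v.
Proof. exact: scalar_funD (fa.1 r) u v. Qed.

Lemma one_formZ r (b : R) (u : tangent r) : a r (b *: u) = b * a r u.
Proof. exact: scalar_funZ (fa.1 r) b u. Qed.

Lemma one_formN r (u : tangent r) : a r (- u) = - a r u.
Proof. by rewrite -scaleN1r one_formZ mulN1r. Qed.

Lemma one_form_sum r (I : Type) (s : seq I) (P : pred I) (u : I -> tangent r) :
  a r (\sum_(i <- s | P i) u i) = \sum_(i <- s | P i) a r (u i).
Proof. exact: scalar_fun_sum (fa.1 r) _ _ _ _. Qed.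

Lemma pullback_along p X (I : finType) c A : along p X (I := I) c A ->
  \forall q \near p, pullback a (X q) = \sum_i c i q * a (F q) (A i (F q)).
Proof.
move=> [_ _ _ XA]; apply: filterS XA => q XAq.
rewrite /pullback XAq one_form_sum; apply: eq_bigr => i _.
exact: one_formZ.
Qed.

Lemma pullback_one_form : one_form (pullback a).
Proof.
split=> [p b u v|p X sX].
  by rewrite /pullback differentialD // differentialZ // one_formD one_formZ.
have [c ac cp] := chart_at (F p).
have HX := along_frame ac cp sX; have [_ sc sA _] := HX.
apply: smooth_at_near_eq (_ : smooth_at p (fun q => \sum_a0
   X q (fun r => c (F r) 0 a0) * a (F q) (dcoord c a0 (F q)))).
  by apply: filterS (pullback_along HX) => q ->.
apply: smooth_at_sum => i _; apply: smooth_atM; first exact: sc.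
apply: (@smooth_at_comp p (fun r => a r (dcoord c i r))).
by apply: fa.2; exact: sA.
Qed.

Lemma cartan_along p X Y (I J : finType) c A d B :
  along p X (I := I) c A -> along p Y (I := J) d B ->
  cartan (pullback a) X Y p =
  \sum_i \sum_j c i p * d j p * cartan a (A i) (B j) (F p).
Proof.
move=> HX HY; have [sX sc sA XA] := HX; have [sY sd sB YB] := HY.
have D (X1 Y1 : vfield N) (I1 J1 : finType) (c1 : I1 -> N -> R) A1 (d1 : J1 -> N -> R) B1 :
    along p X1 c1 A1 -> along p Y1 d1 B1 ->
    X1 p (fun q => pullback a (Y1 q)) = \sum_j X1 p (d1 j) * a (F p) (B1 j (F p)) +
    \sum_i \sum_j c1 i p * d1 j p * A1 i (F p) (fun r => a r (B1 j r)).
  move=> HX1 HY1; have [_ _ _ XA1] := HX1; have [sY1 sd1 sB1 _] := HY1.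
  have sb j : smooth_at p ((fun r => a r (B1 j r)) \o F).
    by apply: smooth_at_comp; apply: fa.2; exact: sB1.
  rewrite (der_near (X1 p) _ (pullback_along HY1)); last first.
    exact: pullback_one_form.2.
  rewrite der_sum => [|j]; last by apply: smooth_atM => //; exact: (sb j).
  rewrite [X in _ = _ + X]exchange_big /= -big_split /=; apply: eq_bigr => j _.
  rewrite (derM _ (sd1 j) (sb j)) /=; congr (_ + _).
  rewrite -differentialE //; last by apply: fa.2; exact: sB1.
  rewrite (nbhs_singleton XA1) tangent_sumE mulr_sumr; apply: eq_bigr => i _.
  by rewrite tangentZE; ring.
rewrite /cartan (D _ _ _ _ _ _ _ _ HX HY) (D _ _ _ _ _ _ _ _ HY HX).
rewrite /pullback (lie_along HX HY) !one_formD one_formN !one_form_sum.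
under [\sum_i a _ (Y p _ *: _)]eq_bigr do rewrite one_formZ.
under [\sum_i a _ (X p _ *: _)]eq_bigr do rewrite one_formZ.
set S1 := \sum_j X p _ * _; set S2 := \sum_i Y p _ * _.
rewrite [\sum_i \sum_j d i p * _ * _]exchange_big /=.
set T1 := \sum_i _; set T2 := \sum_j _; set T3 := \sum_i _.
have -> : S1 + T1 - (S2 + T2) - (S1 - S2 + T3) = T1 - T2 - T3 by ring.
rewrite /T1 /T2 /T3 -!sumrN -!big_split /=; apply: eq_bigr => i _.
rewrite one_form_sum -!sumrN -!big_split /=; apply: eq_bigr => j _.
by rewrite one_formZ; ring.
Qed.

End OneForm.

End Along.

(** * The exterior derivative of a one-form *)

Section Extd.
Context {R : realType} {n : nat} {M : manifold R n}.
Implicit Types (p q : M) (X Y : vfield M) (a : covector_field M).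

Lemma pullback_id a : pullback id a = a.
Proof.
apply: functional_extensionality_dep => p; apply/funext => u.
by rewrite /pullback differential_id.
Qed.

Lemma cartan_coord a (c : chart R M n) p X Y : one_form a ->
  admissible c -> cdom c p -> smooth_vf_at p X -> smooth_vf_at p Y ->
  cartan a X Y p = \sum_i \sum_j X p (fun r => c r 0 i) * Y p (fun r => c r 0 j) *
    cartan a (dcoord c i) (dcoord c j) p.
Proof.
move=> fa ac cp sX sY; have sI := smooth_map_id M.
have HX := along_frame sI ac cp sX; have HY := along_frame sI ac cp sY.
by have := cartan_along sI fa HX HY; rewrite pullback_id.
Qed.

(** The three-term formula is bilinear over functions, so its value at a point
    depends only on the values of the two fields there; hence it computes the
    exterior derivative for every choice of the extensions. *)
Lemma extdE a p X Y : one_form a -> smooth_vf_at p X -> smooth_vf_at p Y ->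
  2 * extd a (X p) (Y p) = cartan a X Y p.
Proof.
move=> fa sX sY; rewrite /extd.
set S := [set r | _].
have [X' [Y' [sX' sY' EX EY ->]]] : S (xget 0 S).
  apply: (@xgetPex _ 0 S); exists (cartan a X Y p / 2), X, Y; split=> //.
  by rewrite mulrC divfK // pnatr_eq0.
have [c ac cp] := chart_at p; rewrite -/(cartan a X' Y' p).
by rewrite !(cartan_coord fa ac cp) // EX EY.
Qed.

Lemma extd_coord a (c : chart R M n) p (u v : tangent p) : one_form a ->
  admissible c -> cdom c p ->
  2 * extd a u v = \sum_i \sum_j u (fun r => c r 0 i) * v (fun r => c r 0 j) *
    cartan a (dcoord c i) (dcoord c j) p.
Proof.
move=> fa ac cp; have [X sX EX] := vf_extension u; have [Y sY EY] := vf_extension v.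
by rewrite -{1}EX -{1}EY extdE // (cartan_coord fa ac cp) // EX EY.
Qed.

Lemma two_neq0 : (2 : R) != 0. Proof. by rewrite pnatr_eq0. Qed.

Lemma extd_linl a p (b : R) (u u' v : tangent p) : one_form a ->
  extd a (b *: u + u') v = b * extd a u v + extd a u' v.
Proof.
move=> fa; have [c ac cp] := chart_at p.
apply: (mulfI two_neq0); rewrite mulrDr mulrCA !(extd_coord _ _ fa ac cp).
rewrite mulr_sumr -big_split; apply: eq_bigr => i _ /=.
rewrite mulr_sumr -big_split; apply: eq_bigr => j _ /=.
transitivity ((b * u (fun r => c r 0 i) + u' (fun r => c r 0 i)) *
  v (fun r => c r 0 j) * cartan a (dcoord c i) (dcoord c j) p); [by []|ring].
Qed.

Lemma cartan_anti a p X Y : one_form a -> smooth_vf_at p X -> smooth_vf_at p Y ->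
  cartan a X Y p = - cartan a Y X p.
Proof.
move=> fa sX sY; rewrite /cartan lie_anti // (one_formN fa); ring.
Qed.

Lemma extd_anti a p (u v : tangent p) : one_form a -> extd a u v = - extd a v u.
Proof.
move=> fa; have [X sX <-] := vf_extension u; have [Y sY <-] := vf_extension v.
by apply: (mulfI two_neq0); rewrite mulrN !extdE // cartan_anti.
Qed.

Lemma extdDl a p (u u' v : tangent p) : one_form a ->
  extd a (u + u') v = extd a u v + extd a u' v.
Proof. by move=> fa; have := extd_linl 1 u u' v fa; rewrite scale1r mul1r. Qed.

Lemma extdZl a p (b : R) (u v : tangent p) : one_form a ->
  extd a (b *: u) v = b * extd a u v.
Proof.
move=> fa; have E0 : extd a (0 : tangent p) v = 0.
  by have := extd_linl (-1) 0 0 v fa; rewrite scaleN1r addNr mulN1r addNr.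
by have := extd_linl b u 0 v fa; rewrite E0 !addr0.
Qed.

Lemma extdZr a p (b : R) (u v : tangent p) : one_form a ->
  extd a u (b *: v) = b * extd a u v.
Proof.
by move=> fa; rewrite (extd_anti u) // extdZl // (extd_anti u v) // mulrN.
Qed.

Lemma extdDr a p (u v v' : tangent p) : one_form a ->
  extd a u (v + v') = extd a u v + extd a u v'.
Proof.
move=> fa; rewrite (extd_anti u) // extdDl // opprD.
by rewrite -!(extd_anti u).
Qed.

Lemma extd_mulf a b (f : M -> R) p (u v : tangent p) : one_form a -> one_form b ->
  smooth_at p f -> (forall q (w : tangent q), a q w = f q * b q w) ->
  2 * extd a u v = u f * b p v - v f * b p u + 2 * (f p * extd b u v).
Proof.
move=> fa fb sf ab; have [X sX <-] := vf_extension u; have [Y sY <-] := vf_extension v.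
rewrite mulrCA !extdE // /cartan ab.
have D (Z W : vfield M) : smooth_vf_at p W ->
    Z p (fun q => a q (W q)) = Z p f * b p (W p) + f p * Z p (fun q => b q (W q)).
  move=> sW; rewrite -derM //; last by apply: fb.2.
  by congr (Z p _); apply/funext => q; rewrite ab.
by rewrite !D //; ring.
Qed.

End Extd.

Section ExtdAlong.
Context {R : realType} {m n : nat} {N : manifold R n} {M : manifold R m}.
Variable F : N -> M.
Hypothesis sF : smooth_map F.

Lemma extd_pullback (a : covector_field M) (p : N) (u v : tangent p) : one_form a ->
  extd (pullback F a) u v = extd a (differential F u) (differential F v).
Proof.
move=> fa; apply: (mulfI (two_neq0 (R := R))).
have [X sX EX] := vf_extension u; have [Y sY EY] := vf_extension v.
have [c ac cp] := chart_at (F p).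
have HX := along_frame sF ac cp sX; have HY := along_frame sF ac cp sY.
rewrite -{1}EX -{1}EY extdE //; last exact: pullback_one_form.
rewrite (cartan_along sF fa HX HY) (extd_coord _ _ fa ac cp).
apply: eq_bigr => i _; apply: eq_bigr => j _.
by rewrite EX EY !differentialE //; exact: smooth_at_coord.
Qed.

(** In coordinates adapted to an integrable J the tensor J has constant
    coefficients; this is its vanishing Nijenhuis tensor, read along F. The
    fields X', Y' of the source are mapped to J X, J Y, so that the derivative
    of a field in the direction J X needs no extension to the target. *)
Lemma integrable_along (J : endo_field M) (p : N) (X Y X' Y' : vfield N) :
  integrable_acs J ->
  [/\ smooth_vf_at p X, smooth_vf_at p Y, smooth_vf_at p X' & smooth_vf_at p Y'] ->
  (\forall q \near p, differential F (X' q) = J (F q) (differential F (X q))) ->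
  (\forall q \near p, differential F (Y' q) = J (F q) (differential F (Y q))) ->
  differential F (lie X' Y' p - lie X Y p) =
  J (F p) (differential F (lie X' Y p + lie X Y' p)).
Proof.
move=> [m' mE HJ] [sX sY sX' sY'] XX' YY'.
have [c [ac cp cJ]] := HJ (F p).
have sc (a : 'I_m) q : cdom c q -> smooth_at q (fun r => c r 0 a).
  by move=> cq; exact: smooth_at_coord.
pose x (a : 'I_m) (q : N) := c (F q) 0 a.
have sx a : smooth_at p (x a) by apply: (smooth_at_comp sF (sc a _ cp)).
have nc := near_map sF (near_cdom cp).
have near_x a : \forall q \near p, smooth_at q (x a).
  by apply: filterS nc => q cq; apply: (smooth_at_comp sF (sc a _ cq)).
have jx (Z Z' : vfield N) (i j : 'I_m) : j = (i + m')%N :> nat ->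
    (\forall q \near p, differential F (Z' q) = J (F q) (differential F (Z q))) ->
    \forall q \near p, Z' q (x i) = - Z q (x j) /\ Z' q (x j) = Z q (x i).
  move=> ij ZZ'; apply: filterS2 ZZ' nc => q ZZq cq.
  have [E1 E2] := cJ _ cq (differential F (Z q)) i j ij.
  have D (W : vfield N) a : differential F (W q) (fun r => c r 0 a) = W q (x a).
    by rewrite differentialE //; exact: sc.
  by rewrite -!ZZq !D in E1 E2.
have lx (Z W : vfield N) a : smooth_vf_at p Z -> smooth_vf_at p W ->
    lie Z W p (x a) = Z p (fun q => W q (x a)) - W p (fun q => Z q (x a)).
  by move=> sZ sW; rewrite lieE.
apply: (tangent_coord_ext ac cp) => a.
have Dx (u : tangent p) b : differential F u (fun r => c r 0 b) = u (x b).
  by rewrite differentialE //; exact: sc.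
have E (u : tangent p) (Z W : vfield N) b b' (e : R) : smooth_vf_at p Z ->
    (\forall q \near p, W q (x b) = e * Z q (x b')) ->
    u (fun q => W q (x b)) = e * u (fun q => Z q (x b')).
  move=> sZ H; rewrite -derZ; last exact: sZ.
  apply/esym/der_near; last by apply: filterS H => q ->.
  by apply: smooth_atM; [exact: smooth_at_cst|exact: sZ].
have solve (i j : 'I_m) : j = (i + m')%N :> nat ->
    (lie X' Y' p - lie X Y p) (x i) = - (lie X' Y p + lie X Y' p) (x j) /\
    (lie X' Y' p - lie X Y p) (x j) = (lie X' Y p + lie X Y' p) (x i).
  move=> ij; have JX := jx X X' i j ij XX'; have JY := jx Y Y' i j ij YY'.
  have X1 (u : tangent p) : u (fun q => X' q (x i)) = -1 * u (fun q => X q (x j)).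
    by apply: E => //; apply: filterS JX => q [-> _]; rewrite mulN1r.
  have X2 (u : tangent p) : u (fun q => X' q (x j)) = 1 * u (fun q => X q (x i)).
    by apply: E => //; apply: filterS JX => q [_ ->]; rewrite mul1r.
  have Y1 (u : tangent p) : u (fun q => Y' q (x i)) = -1 * u (fun q => Y q (x j)).
    by apply: E => //; apply: filterS JY => q [-> _]; rewrite mulN1r.
  have Y2 (u : tangent p) : u (fun q => Y' q (x j)) = 1 * u (fun q => Y q (x i)).
    by apply: E => //; apply: filterS JY => q [_ ->]; rewrite mul1r.
  rewrite !tangentDE !tangentNE !lx // !(X1, X2, Y1, Y2).
  by split; ring.
have [am|am] := ltnP a m'.
  have jm : (a + m' < m)%N by rewrite [X in (_ < X)%N]mE mul2n -addnn ltn_add2r.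
  have [E1 E2] := cJ _ cp (differential F (lie X' Y p + lie X Y' p)) a
    (Ordinal jm) erefl.
  by rewrite E1 !Dx; have [-> _] := solve a (Ordinal jm) erefl.
have im : (a - m' < m)%N by apply: leq_ltn_trans (ltn_ord a); exact: leq_subr.
have ij : a = (Ordinal im + m')%N :> nat by rewrite /= subnK.
have [E1 E2] := cJ _ cp (differential F (lie X' Y p + lie X Y' p)) _ _ ij.
by rewrite E2 !Dx; have [_ ->] := solve _ _ ij.
Qed.

End ExtdAlong.

(** * Powers of a two-form on a symplectic family *)

Section PairArithmetic.
Local Open Scope nat_scope.

Lemma half_pair (x y y' : nat) : x != y -> x./2 = y./2 -> y = bump x y' ->
  exists j, y' = j.*2 /\ ((x = j.*2 /\ y = j.*2.+1) \/ (x = j.*2.+1 /\ y = j.*2)).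
Proof.
move=> xy hxy yE; exists x./2.
have Ex := odd_double_half x; have Ey := odd_double_half y; rewrite -hxy in Ey.
have [xy1|xy1] : y = x.+1 \/ x = y.+1 by move: xy Ex Ey; lia.
- have -> : y' = x by move: yE; rewrite /bump; case: leqP; lia.
  by move: Ex Ey; rewrite xy1 /=; case: (odd x) => /=; lia.
- have -> : y' = y by move: yE; rewrite /bump; case: leqP; lia.
  by move: Ex Ey; rewrite xy1 /=; case: (odd y) => /=; lia.
Qed.

Lemma bump_pair (j x z : nat) : x = j.*2 \/ x = j.*2.+1 ->
  bump x (bump j.*2 z) = z + (j <= z./2).*2.
Proof.
by move=> xj; rewrite /bump -leq_double -[z in RHS]odd_double_half; lia.
Qed.

Lemma half_bump (j a b : nat) :
  ((a + (j <= a./2).*2)./2 == (b + (j <= b./2).*2)./2) = (a./2 == b./2).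
Proof. by rewrite !halfD !doubleK odd_double andbF; lia. Qed.

Lemma lt_bump (j a b : nat) :
  (a + (j <= a./2).*2 < b + (j <= b./2).*2) = (a < b).
Proof. lia. Qed.

End PairArithmetic.

Section Wedge.
Context {R : realType} {n : nat} {M : manifold R n}.

(** Translation by t permutes the terms of the sum defining the wedge product. *)
Lemma wedge_alternating j l (a : Defs.form M j) (b : Defs.form M l) p
    (v : 'I_(j + l) -> tangent p) (t : 'S_(j + l)) :
  wedge a b (fun x => v (t x)) = (-1) ^+ t * wedge a b v.
Proof.
rewrite /wedge [RHS]mulrCA; congr (_ * _).
rewrite [in RHS](reindex_inj (mulIg t)) mulr_sumr; apply: eq_bigr => s _ /=.
rewrite odd_permM signr_addb !mulrA.
rewrite [(-1) ^+ t * _]mulrC -[_ * _ * (-1) ^+ t]mulrA -signr_addb addbb mulr1.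
by congr (_ * a p _ * b p _); apply/funext => x; rewrite permM.
Qed.

Lemma wedge_pow_alternating (b : Defs.form M 2) l p (v : 'I_(l * 2) -> tangent p)
    (t : 'S_(l * 2)) :
  wedge_pow b l p (fun x => v (t x)) = (-1) ^+ t * wedge_pow b l p v.
Proof.
case: l v t => [|l] v t; last exact: wedge_alternating.
have -> : t = 1%g by apply/permP => -[].
by rewrite odd_perm1 mul1r.
Qed.

(** Deleting the positions 0 and 1 together with their images leaves t; in this
    form the sign of s is read off from that of t. *)
Lemma perm_lift2 l (s : 'S_l.+2) (x : 'I_l.+2) (y : 'I_l.+1) :
  s ord0 = x -> s (lift ord0 ord0) = lift x y ->
  exists t : 'S_l, s = lift_perm ord0 x (lift_perm ord0 y t).
Proof.
move=> s0 s1.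
have H (z : 'I_l) : exists z', lift x (lift y z') = s (lift ord0 (lift ord0 z)).
  have /unlift_some[z1 Ez _] : x != s (lift ord0 (lift ord0 z)).
    by rewrite -s0 (inj_eq perm_inj); exact: neq_lift.
  have /unlift_some[z2 Ez2 _] : y != z1.
    apply/eqP => yz1; have /eqP := neq_lift ord0 z; apply.
    by apply/(@lift_inj _ ord0)/(@perm_inj _ s); rewrite s1 Ez yz1.
  by exists z2; rewrite -Ez2 Ez.
have [f Hf] := fin_all_exists H.
have f_inj : injective f.
  move=> a b fab; have := Hf a; rewrite fab Hf => /perm_inj.
  by move/lift_inj/lift_inj.
exists (perm f_inj); apply/permP => z.
case: (unliftP ord0 z) => [z1|] ->; last by rewrite lift_perm_id.
rewrite lift_perm_lift.
case: (unliftP ord0 z1) => [z2|] ->; last by rewrite lift_perm_id.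
by rewrite lift_perm_lift permE Hf.
Qed.

Lemma perm_lift1 l (s : 'S_l.+1) : s ord0 = ord0 ->
  exists t : 'S_l, s = lift_perm ord0 ord0 t.
Proof.
move=> s0.
have H (z : 'I_l) : exists z', lift ord0 z' = s (lift ord0 z).
  have /unlift_some[z1 Ez _] : ord0 != s (lift ord0 z).
    by rewrite -{1}s0 (inj_eq perm_inj); exact: neq_lift.
  by exists z1.
have [f Hf] := fin_all_exists H.
have f_inj : injective f.
  by move=> a b fab; have := Hf a; rewrite fab Hf => /perm_inj/lift_inj.
exists (perm f_inj); apply/permP => z.
case: (unliftP ord0 z) => [z1|] ->; last by rewrite lift_perm_id.
by rewrite lift_perm_lift permE Hf.
Qed.

(** The pairs are (v 0, v 1), (v 2, v 3), ... *)
Definition symplectic_family {l : nat} (b : bilin_field M) (lam : R) p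
    (v : 'I_l -> tangent p) : Prop :=
  forall x y : 'I_l, b p (v x) (v y) =
    if (x./2 == y./2)%N then if (x < y)%N then lam else if (y < x)%N then - lam else 0
    else 0.

(** Only the permutations that send the positions 0 and 1 to one of the pairs
    contribute. For these, the sign of the permutation cancels the signs of the
    two factors, so that all contributions are equal and cannot cancel. *)
Lemma wedge_pow_symplectic (b : bilin_field M) (lam : R) p l :
  exists2 K : R, 0 < K & forall v : 'I_(l * 2) -> tangent p,
    symplectic_family b lam v -> wedge_pow (form2 b) l p v = K * lam ^+ l.
Proof.
elim: l => [|l [K K0 IH]]; first by exists 1 => // v _; rewrite mulr1.
pose paired (s : 'S_(2 + l * 2)) :=
  ((s (lshift _ ord0))./2 == (s (lshift _ (ord_max : 'I_2)))./2)%N.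
exists (((2 + l * 2)`!%:R)^-1 * (\sum_(s : 'S_(2 + l * 2)) (paired s)%:R) * K).
  rewrite !mulr_gt0 // ?invr_gt0 ?ltr0n ?fact_gt0 //.
  rewrite (bigD1 1%g) //= ltr_pwDl //; last by apply: sumr_ge0 => s _; exact: ler0n.
  by rewrite /paired !perm1.
move=> v Sv; rewrite /= /wedge -!mulrA; congr (_ * _).
rewrite mulr_suml; apply: eq_bigr => s _; rewrite /form2 Sv -/(paired s).
set x := s (lshift _ ord0); set y := s (lshift _ ord_max).
case: (boolP (paired s)) => ps; last by rewrite mulr0 !mul0r.
have xy : x != y by rewrite (inj_eq perm_inj).
have E0 : s ord0 = x by congr (s _); exact: val_inj.
have [y' Ey _] := unlift_some xy.
have E1 : s (lift ord0 ord0) = lift x y'.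
  by rewrite -Ey; congr (s _); exact: val_inj.
have [t Et] := perm_lift2 E0 E1.
have vE : (fun z : 'I_(l * 2) => v (s (rshift 2 z))) =
    (fun z => v (lift x (lift y' (t z)))).
  apply/funext => z; congr v; rewrite {1}Et.
  have -> : rshift 2 z = lift ord0 (lift ord0 z) by exact: val_inj.
  by rewrite !lift_perm_lift.
rewrite vE (wedge_pow_alternating _ (fun z => v (lift x (lift y' z)))).
have hxy : (x./2 = y./2)%N by apply/eqP.
have valy : (y = bump x y' :> nat)%N by rewrite Ey.
have valxy : (x != y :> nat)%N by [].
have [j [Ey' Exy]] := half_pair valxy hxy valy.
have Ex : (x = j.*2 :> nat \/ x = j.*2.+1 :> nat)%N.
  by case: Exy => -[? _]; [left|right].
have bumpE (z : 'I_(l * 2)) : bump x (bump y' z) = (z + (j <= z./2).*2)%N.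
  by rewrite Ey' bump_pair.
have Su : symplectic_family b lam (fun z => v (lift x (lift y' z))).
  by move=> z1 z2; rewrite Sv /= !bumpE half_bump !lt_bump.
rewrite IH // Et !odd_lift_perm /= Ey' odd_double exprS /=.
have sq : (-1) ^+ t * (-1) ^+ t = 1 :> R by rewrite -signr_addb addbb.
have finish (e c d : R) : e * e = 1 -> e * lam * (e * (c * d)) = c * (lam * d).
  by move=> ee; rewrite mulrACA ee mul1r mulrCA.
case: Exy => -[-> ->].
  by rewrite odd_double ltnSn addFb mul1r finish.
rewrite ltnNge leqnSn ltnSn /= odd_double addTb signrN mul1r mulrNN.
exact: finish.
Qed.

(** Only the permutations that fix 0 contribute, all of them equally. *)
Lemma contact_volume_neq0 (w : covector_field M) (b : bilin_field M) (lam : R) p l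
    (v : 'I_(1 + l * 2) -> tangent p) :
  lam != 0 -> (forall x, w p (v x) = (x == ord0)%:R) ->
  symplectic_family b lam (fun z => v (rshift 1 z)) ->
  wedge (form1 w) (wedge_pow (form2 b) l) v != 0.
Proof.
move=> lam0 wv Sv; have [K K0 HK] := wedge_pow_symplectic b lam p l.
have -> : wedge (form1 w) (wedge_pow (form2 b) l) v = ((1 + l * 2)`!%:R)^-1 *
    ((\sum_(s : 'S_(1 + l * 2)) (s ord0 == ord0)%:R) * (K * lam ^+ l)).
  rewrite /wedge; congr (_ * _); rewrite mulr_suml; apply: eq_bigr => s _.
  rewrite /form1 wv.
  have -> : lshift (l * 2) (ord0 : 'I_1) = ord0 by exact: val_inj.
  case: eqP => [s0|_]; last by rewrite mulr0 !mul0r.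
  have [t Et] := perm_lift1 s0.
  have vE : (fun z : 'I_(l * 2) => v (s (rshift 1 z))) =
      (fun z => v (rshift 1 (t z))).
    apply/funext => z; congr v; rewrite Et.
    have R1 (y : 'I_(l * 2)) : rshift 1 y = lift ord0 y by exact: val_inj.
    by rewrite !R1 lift_perm_lift.
  rewrite vE (wedge_pow_alternating _ (fun z => v (rshift 1 z))) HK //.
  by rewrite Et odd_lift_perm /= mulr1 mulrA -signr_addb addbb.
have c0 : 0 < \sum_(s : 'S_(1 + l * 2)) (s ord0 == ord0)%:R :> R.
  rewrite (bigD1 1%g) //= ltr_pwDl //; last by apply: sumr_ge0 => s _; exact: ler0n.
  by rewrite perm1 eqxx.
by rewrite !mulf_neq0 ?invr_neq0 ?expf_neq0 ?(gt_eqF c0) ?(gt_eqF K0) // pnatr_eq0 -lt0n fact_gt0.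
Qed.

End Wedge.

(** * Frames adapted to phi in a tangent space *)

Section TangentLinear.
Context {R : realType} {n : nat} {M : manifold R n} (p : M).

Lemma tangent_kernel k (L : 'I_k -> tangent p -> R) : (k < n)%N ->
  (forall i, scalar (L i)) -> exists2 u : tangent p, u != 0 & forall i, L i u = 0.
Proof.
move=> kn sL; have [c ac cp] := chart_at p.
pose A := \matrix_(a < n, i < k) L i (dcoord c a p).
have K0 : kermx A != 0.
  by rewrite -mxrank_eq0 mxrank_ker -lt0n subn_gt0; apply: leq_ltn_trans (rank_leq_col A) kn.
pose r := nz_row (kermx A).
have r0 : r != 0 by rewrite nz_row_eq0.
have /sub_kermxP rA : (r <= kermx A)%MS by exact: nz_row_sub.
exists (\sum_a r 0 a *: dcoord c a p).
  apply: contraNneq r0 => u0; apply/eqP/rowP => b; rewrite mxE.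
  have := congr1 (fun u : tangent p => u (fun q => c q 0 b)) u0.
  rewrite /= tangent_sumE (bigD1 b) //= big1 => [|a ab].
    by rewrite addr0 tangentZE dcoord_coord // eqxx mulr1.
  by rewrite tangentZE dcoord_coord // (negbTE ab) mulr0.
move=> i; rewrite (scalar_fun_sum (sL i)).
have := congr1 (fun B : 'rV_k => B 0 i) rA; rewrite !mxE => rA0.
by apply: etrans _ rA0; apply: eq_bigr => a _; rewrite (scalar_funZ (sL i)) mxE.
Qed.

Lemma tangent_dependent k (v : 'I_k -> tangent p) : (n < k)%N ->
  exists2 r : 'rV[R]_k, r != 0 & \sum_i r 0 i *: v i = 0.
Proof.
move=> nk; have [c ac cp] := chart_at p.
pose A := \matrix_(i < k, a < n) v i (fun q => c q 0 a).
have K0 : kermx A != 0.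
  by rewrite -mxrank_eq0 mxrank_ker -lt0n subn_gt0; apply: leq_ltn_trans (rank_leq_col A) nk.
exists (nz_row (kermx A)); first by rewrite nz_row_eq0.
have /sub_kermxP rA : (nz_row (kermx A) <= kermx A)%MS by exact: nz_row_sub.
apply: (tangent_coord_ext ac cp) => a; rewrite tangent_sumE tangent0E.
have := congr1 (fun B : 'rV_n => B 0 a) rA; rewrite !mxE => rA0.
by apply: etrans _ rA0; apply: eq_bigr => i _; rewrite mxE.
Qed.

Section Frame.
Variables (g : tangent p -> tangent p -> R) (phi : tangent p -> tangent p).
Variable z : tangent p.
Hypothesis gl : forall u, scalar (g u).
Hypothesis gs : forall u v, g u v = g v u.
Hypothesis gp : forall u, u != 0 -> 0 < g u u.
Hypothesis phi_skew : forall u v, g u (phi v) = - g (phi u) v.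
Hypothesis phi2 : forall u, phi (phi u) = - u + g z u *: z.
Hypothesis gz : g z z = 1.
Hypothesis phiz : phi z = 0.

Lemma gr0 u : g u 0 = 0.
Proof. exact: scalar_fun0 (gl u). Qed.
Lemma grD u v w : g u (v + w) = g u v + g u w.
Proof. exact: scalar_funD (gl u) v w. Qed.
Lemma grZ u b v : g u (b *: v) = b * g u v.
Proof. exact: scalar_funZ (gl u) b v. Qed.
Lemma grN u v : g u (- v) = - g u v.
Proof. by rewrite -scaleN1r grZ mulN1r. Qed.
Lemma glZ u b v : g (b *: u) v = b * g u v.
Proof. by rewrite gs grZ gs. Qed.

Lemma phi_selfskew u : g u (phi u) = 0.
Proof.
have := phi_skew u u; rewrite [in RHS]gs => /eqP.
by rewrite -subr_eq0 opprK -mulr2n mulrn_eq0 /= => /eqP.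
Qed.

Lemma g_z_phi u : g z (phi u) = 0.
Proof. by rewrite phi_skew phiz gs gr0 oppr0. Qed.

Lemma g_phi_phi u v : g (phi u) (phi v) = g u v - g z u * g z v.
Proof.
by rewrite phi_skew phi2 gs grD grN grZ (gs v z) (gs v u); ring.
Qed.

(** The frame meant is z, e 0, phi (e 0), e 1, phi (e 1), ...; its orthonormality
    follows from these relations because phi is skew and kills z. *)
Definition phi_frame (l : nat) (e : nat -> tangent p) : Prop :=
  forall i j, (i < l)%N -> (j < l)%N ->
    [/\ g z (e i) = 0, g (e i) (e j) = (i == j)%:R & g (e i) (phi (e j)) = 0].

Definition frame_vec (e : nat -> tangent p) (x : nat) : tangent p :=
  if x is x'.+1 then if odd x' then phi (e x'./2) else e x'./2 else z.

Lemma frame_vec_orthonormal l e x y : phi_frame l e ->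
  (x < 1 + l * 2)%N -> (y < 1 + l * 2)%N -> g (frame_vec e x) (frame_vec e y) = (x == y)%:R.
Proof.
move=> fe; case: x => [|x] xl; case: y => [|y] yl /=.
- exact: gz.
- have [i1 i2] : (y./2 < l)%N /\ (y./2 < l)%N by lia.
  by case: ifP => _; rewrite ?g_z_phi //; have [] := fe _ _ i1 i2.
- have [i1 i2] : (x./2 < l)%N /\ (x./2 < l)%N by lia.
  by rewrite gs; case: ifP => _; rewrite ?g_z_phi //; have [] := fe _ _ i1 i2.
- have [i1 i2] : (x./2 < l)%N /\ (y./2 < l)%N by lia.
  have [E1 E2 E3] := fe _ _ i1 i2; have [E1' E2' E3'] := fe _ _ i2 i1.
  have xyE : (x.+1 == y.+1) = (odd x == odd y) && (x./2 == y./2)%N by lia.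
  rewrite xyE; case: (odd x); case: (odd y) => //=.
  + by rewrite g_phi_phi E1 mul0r subr0 E2.
  + by rewrite gs.
Qed.

Lemma phi_frame_bound l e : phi_frame l e -> (1 + l * 2 <= n)%N.
Proof.
move=> fe; rewrite leqNgt; apply/negP => nl.
have [r r0 rv] := tangent_dependent (fun i : 'I_(1 + l * 2) => frame_vec e i) nl.
move/eqP: r0; apply; apply/rowP => j; rewrite mxE.
have := gr0 (frame_vec e j); rewrite -rv (scalar_fun_sum (gl _)).
rewrite (bigD1 j) //= big1 => [|i ij].
  by rewrite addr0 grZ (frame_vec_orthonormal fe) // eqxx mulr1.
rewrite grZ (frame_vec_orthonormal fe) //.
by rewrite eq_sym -val_eqE /= in ij; rewrite (negbTE ij) mulr0.
Qed.

(** A unit vector u orthogonal to the frame exists for lack of dimension, and phi u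
    is then orthogonal to the frame and to u. *)
Lemma phi_frame_extend l e : phi_frame l e -> (1 + l * 2 < n)%N ->
  exists e', phi_frame l.+1 e'.
Proof.
move=> fe ln.
have [u u0 Hu] := tangent_kernel ln (fun i : 'I_(1 + l * 2) => gl (frame_vec e i)).
have gu0 := gp u0; pose b := (Num.sqrt (g u u))^-1.
pose e' i := if (i < l)%N then e i else b *: u.
have zu : g z u = 0 by exact: (Hu ord0).
have eu i : (i < l)%N -> g (e i) u = 0.
  move=> il; have H : (1 + i * 2 < 1 + l * 2)%N by lia.
  by have := Hu (Ordinal H); rewrite /= muln2 odd_double doubleK.
have peu i : (i < l)%N -> g (phi (e i)) u = 0.
  move=> il; have H : (1 + (1 + i * 2) < 1 + l * 2)%N by lia.
  have := Hu (Ordinal H); rewrite /= muln2 odd_double /=.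
  by rewrite uphalf_double.
have phiZ v : g v (phi (b *: u)) = b * g v (phi u).
  by rewrite !phi_skew grZ; ring.
exists e' => i j; rewrite !ltnS => il jl; rewrite /e'.
case: (ltnP i l) => [il'|li]; case: (ltnP j l) => [jl'|lj].
- exact: fe.
- have ij : (i == j) = false by lia.
  rewrite ij grZ phiZ eu // phi_skew peu // oppr0 !mulr0; split=> //.
  by have [] := fe _ _ il' il'.
- have ij : (i == j) = false by lia.
  by rewrite ij !glZ grZ zu (gs u (e j)) eu // (gs u (phi (e j))) peu // !mulr0.
- have -> : i = l by lia.
  have -> : j = l by lia.
  rewrite eqxx glZ !grZ zu phiZ glZ phi_selfskew; split; [by ring| |by ring].
  rewrite /b mulrA -expr2 exprVn sqr_sqrtr ?(ltW gu0) // mulVf //.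
  by rewrite gt_eqF.
Qed.

(** Frames grow by two vectors as long as they do not span the tangent space;
    hence the dimension is odd and a frame of full length exists. *)
Lemma phi_frame_exists : exists2 l, n = (1 + l * 2)%N & exists e, phi_frame l e.
Proof.
have step l : (1 + l * 2 <= n)%N -> exists e, phi_frame l e.
  elim: l => [_|l IH ln]; first by exists (fun=> 0).
  have [e fe] := IH ltac:(lia).
  by apply: (phi_frame_extend fe); lia.
have [e0 f0] : exists e, phi_frame 0 e by exists (fun=> 0).
have n0 := phi_frame_bound f0.
exists n.-1./2; last by apply: step; lia.
have [e fe] := step n.-1./2 ltac:(lia).
have := phi_frame_bound fe => le1.
apply/eqP; rewrite eqn_leq le1 andbT leqNgt; apply/negP => /(phi_frame_extend fe).
by move=> [e' /phi_frame_bound]; lia.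
Qed.

End Frame.
End TangentLinear.

(** * Riemannian metrics *)

Section Riemannian.
Context {R : realType} {n : nat} {M : manifold R n} (g : bilin_field M).
Arguments g : clear implicits.
Hypothesis rg : riemannian g.

Lemma riemannian_sym p (u v : tangent p) : g p u v = g p v u.
Proof. by have [_ + _ _] := rg; apply. Qed.

Lemma riemannian_gt0 p (u : tangent p) : u != 0 -> 0 < g p u u.
Proof. by have [_ _ + _] := rg; apply. Qed.

Lemma riemannian0r p (u : tangent p) : g p u 0 = 0.
Proof. by have [gl _ _ _] := rg; exact: scalar_fun0 (gl p u). Qed.

Lemma riemannianDr p (u v w : tangent p) : g p u (v + w) = g p u v + g p u w.
Proof. by have [gl _ _ _] := rg; exact: scalar_funD (gl p u) v w. Qed.

Lemma riemannianZr p (u : tangent p) (b : R) v : g p u (b *: v) = b * g p u v.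
Proof. by have [gl _ _ _] := rg; exact: scalar_funZ (gl p u) b v. Qed.

Lemma riemannianNr p (u v : tangent p) : g p u (- v) = - g p u v.
Proof. by rewrite -scaleN1r riemannianZr mulN1r. Qed.

Lemma riemannianDl p (u v w : tangent p) : g p (v + w) u = g p v u + g p w u.
Proof. by rewrite riemannian_sym riemannianDr !(riemannian_sym u). Qed.

Lemma riemannianZl p (u : tangent p) (b : R) v : g p (b *: v) u = b * g p v u.
Proof. by rewrite riemannian_sym riemannianZr riemannian_sym. Qed.

Lemma riemannianNl p (u v : tangent p) : g p (- u) v = - g p u v.
Proof. by rewrite -scaleN1r riemannianZl mulN1r. Qed.

Lemma riemannian_sumr p (I : finType) (F : I -> tangent p) v :
  g p v (\sum_a F a) = \sum_a g p v (F a).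
Proof. by have [gl _ _ _] := rg; exact: scalar_fun_sum (gl p v) _ _ _ _. Qed.

Lemma riemannian_suml p (I : finType) (F : I -> tangent p) v :
  g p (\sum_a F a) v = \sum_a g p (F a) v.
Proof.
rewrite riemannian_sym riemannian_sumr.
by apply: eq_bigr => a _; rewrite riemannian_sym.
Qed.

Lemma riemannian_eq0 p (u : tangent p) : g p u u = 0 -> u = 0.
Proof.
by move=> guu; have [//|/riemannian_gt0] := eqVneq u 0; rewrite guu ltxx.
Qed.

Section Gram.
Variable c : chart R M n.
Hypothesis ac : admissible c.

Definition gram (q : M) : 'M[R]_n := \matrix_(a, b) g q (dcoord c a q) (dcoord c b q).

Lemma gram_row q (x : 'rV[R]_n) b :
  (x *m gram q) 0 b = g q (\sum_a x 0 a *: dcoord c a q) (dcoord c b q).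
Proof.
rewrite !mxE riemannian_suml; apply: eq_bigr => a _.
by rewrite mxE riemannianZl.
Qed.

Lemma gram_unit q : cdom c q -> gram q \in unitmx.
Proof.
move=> cq; rewrite -row_free_unit; apply: inj_row_free => x x0.
pose u := \sum_a x 0 a *: dcoord c a q.
have u0 : u = 0.
  apply: riemannian_eq0; rewrite {2}/u riemannian_sumr big1 // => b _.
  by rewrite riemannianZr -gram_row x0 mxE mulr0.
apply/rowP => b; rewrite mxE.
transitivity (u (fun r => c r 0 b)); last by rewrite u0.
rewrite tangent_sumE (bigD1 b) //= big1 => [|a ab].
  by rewrite addr0 tangentZE dcoord_coord // eqxx mulr1.
by rewrite tangentZE dcoord_coord // (negbTE ab) mulr0.
Qed.

Lemma gram_solve q (u : tangent q) : cdom c q ->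
  u = \sum_a (\sum_b g q u (dcoord c b q) * invmx (gram q) b a) *: dcoord c a q.
Proof.
move=> cq; pose x : 'rV[R]_n := \row_a u (fun r => c r 0 a).
have Eu : u = \sum_a x 0 a *: dcoord c a q.
  by rewrite {1}(tangent_coordE ac u cq); apply: eq_bigr => a _; rewrite mxE.
rewrite {1}Eu; apply: eq_bigr => a _; congr (_ *: _).
rewrite -[x](mulmxK (gram_unit cq)) mxE; apply: eq_bigr => b _.
by rewrite gram_row -Eu.
Qed.

End Gram.

Lemma riesz p (L : tangent p -> R) : scalar L -> exists v, forall u, g p v u = L u.
Proof.
move=> sL; have [c ac cp] := chart_at p.
pose x := (\row_b L (dcoord c b p)) *m invmx (gram c p).
exists (\sum_a x 0 a *: dcoord c a p) => u.
rewrite (tangent_coordE ac u cp) riemannian_sumr (scalar_fun_sum sL).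
apply: eq_bigr => b _; rewrite riemannianZr (scalar_funZ sL) -gram_row mulmxKV ?mxE //.
exact: gram_unit.
Qed.

(** Over the domain of a chart, X is recovered from its products with the
    coordinate fields by the inverse of their Gram matrix. *)
Lemma smooth_vf_riemannian p (X : vfield M) :
  (forall Y, smooth_vf_at p Y -> smooth_at p (fun q => g q (X q) (Y q))) ->
  smooth_vf_at p X.
Proof.
move=> HX; have [c ac cp] := chart_at p.
have sE a : smooth_vf_at p (dcoord c a) by exact: smooth_dcoord.
apply: (@smooth_vf_near _ _ _ _ (fun q => \sum_a (\sum_b g q (X q) (dcoord c b q) *
  invmx (gram c q) b a) *: dcoord c a q)).
  by apply: filterS (near_cdom cp) => q cq; rewrite -gram_solve.
apply: smooth_vf_sum => a; apply: smooth_vfZ => //.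
apply: smooth_at_sum => b _; apply: smooth_atM; first exact: HX.
apply: smooth_at_invmx => [|i j].
  by apply: filterS (near_cdom cp) => q cq; exact: gram_unit.
have [_ _ _ sg] := rg.
by under eq_fun do rewrite mxE; exact: sg.
Qed.

End Riemannian.

(** * Tensoriality of the Nijenhuis torsion *)

Section LieMore.
Context {R : realType} {n : nat} {M : manifold R n}.
Implicit Types (p q : M) (X Y : vfield M).

Lemma lieNl p X Y : smooth_vf_at p X -> smooth_vf_at p Y ->
  lie (fun q => - X q) Y p = - lie X Y p.
Proof.
move=> sX sY; have -> : (fun q => - X q) = (fun q => -1 *: X q).
  by apply: functional_extensionality_dep => q; rewrite scaleN1r.
rewrite (lieZl (@smooth_at_cst _ _ _ p (-1)) sX sY).
by rewrite der_cst scale0r subr0 scaleN1r.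
Qed.

Lemma lie0l p Y : smooth_vf_at p Y -> lie (fun q => 0 : tangent q) Y p = 0.
Proof.
move=> sY; have s0 : smooth_vf_at p (fun q => 0 : tangent q) by exact: smooth_vf0.
have := lieNl s0 sY.
rewrite (_ : (fun q => - 0) = (fun q => 0 : tangent q)).
  move=> /eqP; rewrite -addr_eq0 -mulr2n -scaler_nat scaler_eq0.
  by rewrite pnatr_eq0 /= => /eqP.
by apply: functional_extensionality_dep => q; rewrite oppr0.
Qed.

Section Nijenhuis.
Variable phi : endo_field M.
Arguments phi : clear implicits.
Hypothesis tphi : tensor11 phi.

Let phiD p (u v : tangent p) : phi p (u + v) = phi p u + phi p v.
Proof. by have := tphi.1 p 1 u v; rewrite !scale1r. Qed.
Let phi0 p : phi p 0 = 0.
Proof. by have := tphi.1 p (-1) 0 0; rewrite !scaleN1r !addNr. Qed.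
Let phiZ p (b : R) (u : tangent p) : phi p (b *: u) = b *: phi p u.
Proof. by have := tphi.1 p b u 0; rewrite phi0 !addr0. Qed.
Let phiN p (u : tangent p) : phi p (- u) = - phi p u.
Proof. by rewrite -scaleN1r phiZ scaleN1r. Qed.

Lemma nijenhuis_anti p X Y : smooth_vf_at p X -> smooth_vf_at p Y ->
  nijenhuis phi X Y p = - nijenhuis phi Y X p.
Proof.
move=> sX sY; have sX' := tphi.2 p X sX; have sY' := tphi.2 p Y sY.
rewrite /nijenhuis (lie_anti sX sY) (lie_anti sX' sY') (lie_anti sX' sY) (lie_anti sX sY').
rewrite !phiN.
by apply: tangent_ext => k sk; rewrite !(tangentDE, tangentNE); ring.
Qed.

Lemma nijenhuisDl p X X' Y : smooth_vf_at p X -> smooth_vf_at p X' ->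
  smooth_vf_at p Y ->
  nijenhuis phi (fun q => X q + X' q) Y p = nijenhuis phi X Y p + nijenhuis phi X' Y p.
Proof.
move=> sX sX' sY; have pX := tphi.2 p X sX; have pX' := tphi.2 p X' sX'.
have pY := tphi.2 p Y sY; rewrite /nijenhuis.
have -> : (fun q => phi q (X q + X' q)) = (fun q => phi q (X q) + phi q (X' q)).
  by apply: functional_extensionality_dep => q; rewrite phiD.
rewrite !lieDl // !phiD.
by apply: tangent_ext => k sk; rewrite !(tangentDE, tangentNE); ring.
Qed.

Lemma nijenhuisZl p f X Y : smooth_at p f -> smooth_vf_at p X ->
  smooth_vf_at p Y ->
  nijenhuis phi (fun q => f q *: X q) Y p = f p *: nijenhuis phi X Y p.
Proof.
move=> sf sX sY; have pX := tphi.2 p X sX.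
have pY := tphi.2 p Y sY; rewrite /nijenhuis.
have -> : (fun q => phi q (f q *: X q)) = (fun q => f q *: phi q (X q)).
  by apply: functional_extensionality_dep => q; rewrite phiZ.
rewrite !lieZl // !(phiD, phiN, phiZ) !scalerDr !scalerN !opprD !opprK.
set A := f p *: phi p (phi p _); set B := Y p f *: phi p (phi p _).
set C := f p *: lie _ _ p; set D := phi p (Y p) f *: _.
set E := f p *: _; set G := f p *: phi p (lie X _ p).
clearbody A B C D E G.
by apply: tangent_ext => k sk; rewrite !(tangentDE, tangentNE); ring.
Qed.

(** If w z = 1, the fields X0 and Y0 lie in the kernel of w: this reduces the
    torsion to its values on that kernel and on z. *)
Lemma nijenhuis_split p (z : vfield M) (w : covector_field M) X Y :
  smooth_vf z -> one_form w -> smooth_vf_at p X -> smooth_vf_at p Y ->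
  let X0 := (fun q => X q - w q (X q) *: z q) : vfield M in
  let Y0 := (fun q => Y q - w q (Y q) *: z q) : vfield M in
  nijenhuis phi X Y p = nijenhuis phi X0 Y0 p + w p (X p) *: nijenhuis phi z Y0 p
    - w p (Y p) *: nijenhuis phi z X0 p.
Proof.
move=> sz fw sX sY X0 Y0; have szp := sz p.
have fX : smooth_at p (fun q => w q (X q)) by exact: fw.2.
have fY : smooth_at p (fun q => w q (Y q)) by exact: fw.2.
have zX := smooth_vfZ fX szp; have zY := smooth_vfZ fY szp.
have sX0 : smooth_vf_at p X0 by exact: smooth_vfB.
have sY0 : smooth_vf_at p Y0 by exact: smooth_vfB.
have split V (f := fun q => w q (V q)) :
    V = (fun q => (V q - f q *: z q) + f q *: z q) :> vfield M.
  by apply: functional_extensionality_dep => q; rewrite subrK.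
have zz : nijenhuis phi z z p = 0.
  have /eqP := nijenhuis_anti szp szp.
  rewrite -addr_eq0 -mulr2n -scaler_nat scaler_eq0.
  by rewrite pnatr_eq0 /= => /eqP.
have HY V : smooth_vf_at p V -> nijenhuis phi V Y p =
    nijenhuis phi V Y0 p + w p (Y p) *: nijenhuis phi V z p.
  move=> sV; rewrite (nijenhuis_anti sV sY) {1}(split Y) nijenhuisDl // nijenhuisZl //.
  by rewrite (nijenhuis_anti sV sY0) (nijenhuis_anti sV szp) opprD scalerN.
have HX : nijenhuis phi X Y p = nijenhuis phi X0 Y p + w p (X p) *: nijenhuis phi z Y p.
  by rewrite {1}(split X) (nijenhuisDl sX0 zX sY) (nijenhuisZl fX szp sY).
rewrite HX (HY X0 sX0) (HY z szp) zz scaler0 addr0.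
by rewrite (nijenhuis_anti sX0 szp) scalerN addrAC.
Qed.

End Nijenhuis.
End LieMore.

(** * Metric contact pairs *)

Section MetricContactPair.
Context {R : realType} {h k m : nat} {M : manifold R m}.
Context {a1 a2 : covector_field M} {Z1 Z2 : vfield M}.
Context {phi : endo_field M} {g : bilin_field M}.
Arguments a1 : clear implicits.
Arguments a2 : clear implicits.
Arguments phi : clear implicits.
Arguments g : clear implicits.
Hypothesis mcp : metric_contact_pair h k a1 a2 Z1 Z2 phi g.

Lemma mcp_form1 : one_form a1.
Proof. by have [[[_ [+ _] _ _ _] _ _ _] _ _] := mcp. Qed.
Lemma mcp_form2 : one_form a2.
Proof. by have [[[_ [_ +] _ _ _] _ _ _] _ _] := mcp. Qed.
Lemma mcp_smooth1 : smooth_vf Z1.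
Proof. by have [[_ [+ _ _] _ _] _ _] := mcp. Qed.
Lemma mcp_smooth2 : smooth_vf Z2.
Proof. by have [[_ [_ + _] _ _] _ _] := mcp. Qed.
Lemma mcp_riemannian : riemannian g.
Proof. by have [_ + _] := mcp. Qed.
Lemma mcp_tensor : tensor11 phi.
Proof. by have [[_ _ + _] _ _] := mcp. Qed.
Lemma mcp_phi2 p (u : tangent p) :
  phi p (phi p u) = - u + a1 p u *: Z1 p + a2 p u *: Z2 p.
Proof. by have [[_ _ _ H] _ _] := mcp; have [] := H p u. Qed.
Lemma mcp_phiZ1 p : phi p (Z1 p) = 0.
Proof. by have [[_ _ _ H] _ _] := mcp; have [] := H p 0. Qed.
Lemma mcp_phiZ2 p : phi p (Z2 p) = 0.
Proof. by have [[_ _ _ H] _ _] := mcp; have [] := H p 0. Qed.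
Lemma mcp_gphi p (u v : tangent p) : g p u (phi p v) = extd a1 u v + extd a2 u v.
Proof. by have [_ _ H] := mcp; have [] := H p u v. Qed.
Lemma mcp_gZ1 p (u : tangent p) : g p u (Z1 p) = a1 p u.
Proof. by have [_ _ H] := mcp; have [] := H p u 0. Qed.
Lemma mcp_gZ2 p (u : tangent p) : g p u (Z2 p) = a2 p u.
Proof. by have [_ _ H] := mcp; have [] := H p u 0. Qed.
Lemma mcp_reeb p : [/\ a1 p (Z1 p) = 1, a1 p (Z2 p) = 0, a2 p (Z1 p) = 0,
  a2 p (Z2 p) = 1 & forall u : tangent p, [/\ extd a1 (Z1 p) u = 0,
  extd a2 (Z1 p) u = 0, extd a1 (Z2 p) u = 0 & extd a2 (Z2 p) u = 0]].
Proof. by have [[_ [_ _ +] _ _] _ _] := mcp; apply. Qed.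

Lemma mcp_phiD p (u v : tangent p) : phi p (u + v) = phi p u + phi p v.
Proof. by have := mcp_tensor.1 p 1 u v; rewrite !scale1r. Qed.
Lemma mcp_phi0 p : phi p 0 = 0.
Proof. by have := mcp_tensor.1 p (-1) 0 0; rewrite !scaleN1r !addNr. Qed.
Lemma mcp_phiZ p (b : R) (u : tangent p) : phi p (b *: u) = b *: phi p u.
Proof. by have := mcp_tensor.1 p b u 0; rewrite mcp_phi0 !addr0. Qed.
Lemma mcp_phiN p (u : tangent p) : phi p (- u) = - phi p u.
Proof. by rewrite -scaleN1r mcp_phiZ scaleN1r. Qed.

Lemma mcp_phi_skew p (u v : tangent p) : g p u (phi p v) = - g p (phi p u) v.
Proof.
rewrite (riemannian_sym mcp_riemannian (phi p u)) !mcp_gphi.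
rewrite (extd_anti u v mcp_form1) (extd_anti u v mcp_form2); ring.
Qed.

Lemma mcp_a1phi p (u : tangent p) : a1 p (phi p u) = 0.
Proof.
rewrite -mcp_gZ1 -[LHS]opprK -mcp_phi_skew mcp_phiZ1.
by rewrite (riemannian0r mcp_riemannian) oppr0.
Qed.

Lemma mcp_a2phi p (u : tangent p) : a2 p (phi p u) = 0.
Proof.
rewrite -mcp_gZ2 -[LHS]opprK -mcp_phi_skew mcp_phiZ2.
by rewrite (riemannian0r mcp_riemannian) oppr0.
Qed.

(** * Normality on the ambient manifold *)

Local Notation acsJ := (fun p u => phi p u - a2 p u *: Z1 p + a1 p u *: Z2 p).
Local Notation acsT := (fun p u => phi p u + a2 p u *: Z1 p - a1 p u *: Z2 p).

(** All the other terms of the three-term formula for da(Z, Y) vanish. *)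
Lemma reeb_lie_ker (a : covector_field M) (Z Y : vfield M) p : one_form a ->
  smooth_vf Z -> (forall q, extd a (Z q) =1 fun=> 0) ->
  (exists b : R, forall q, a q (Z q) = b) -> smooth_vf_at p Y ->
  (\forall q \near p, a q (Y q) = 0) -> a p (lie Z Y p) = 0.
Proof.
move=> fa sZ Z0 [b Zb] sY aY.
have := extdE fa (sZ p) sY; rewrite Z0 mulr0 /cartan.
rewrite (der_near (Z p) (fa.2 p Y sY) aY) der_cst.
rewrite (_ : (fun q => a q (Z q)) = fun=> b); last by apply/funext => q.
by rewrite der_cst subr0 sub0r => /esym/eqP; rewrite oppr_eq0 => /eqP.
Qed.

(** Adding and subtracting the two integrability conditions for (Z1, Y), where
    acsJ Z1 = Z2 and acsT Z1 = - Z2, shows that both Reeb fields preserve phi on the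
    common kernel of the forms. *)
Lemma reeb_lie_phi p (Y : vfield M) : normal_contact_pair a1 a2 Z1 Z2 phi ->
  smooth_vf_at p Y ->
  (\forall q \near p, a1 q (Y q) = 0) -> (\forall q \near p, a2 q (Y q) = 0) ->
  lie Z1 (fun q => phi q (Y q)) p = phi p (lie Z1 Y p) /\
  lie Z2 (fun q => phi q (Y q)) p = phi p (lie Z2 Y p).
Proof.
move=> [iJ iT] sY Y1 Y2; have sI := smooth_map_id M.
have s1 := @mcp_smooth1 p; have s2 := @mcp_smooth2 p.
pose Y' : vfield M := fun q => phi q (Y q).
have sY' : smooth_vf_at p Y' by exact: mcp_tensor.2.
pose nZ2 : vfield M := fun q => - Z2 q.
have sn : smooth_vf_at p nZ2 by exact: smooth_vfN.
have EJ := @integrable_along _ _ _ M M id sI acsJ p Z1 Y Z2 Y' iJ.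
have ET := @integrable_along _ _ _ M M id sI acsT p Z1 Y nZ2 Y' iT.
move: EJ ET => /(_ _ _ _)/wrap[]; first by split.
- apply: nearW => q /=; rewrite !differential_id mcp_phiZ1.
  have [-> _ -> _ _] := mcp_reeb q.
  by rewrite scale0r subr0 add0r scale1r.
- by apply: filterS2 Y1 Y2 => q E1 E2 /=; rewrite !differential_id E1 E2 !scale0r subr0 addr0.
move=> EJ /(_ _ _ _)/wrap[]; first by split.
- apply: nearW => q /=; rewrite !differential_id mcp_phiZ1.
  have [-> _ -> _ _] := mcp_reeb q.
  by rewrite scale0r addr0 add0r scale1r.
- by apply: filterS2 Y1 Y2 => q E1 E2 /=; rewrite !differential_id E1 E2 !scale0r subr0 addr0.
move=> ET.
have {}EJ : lie Z2 Y' p - lie Z1 Y p = acsJ p (lie Z2 Y p + lie Z1 Y' p).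
  by move: EJ; rewrite !differential_id.
have {}ET : - lie Z2 Y' p - lie Z1 Y p = acsT p (- lie Z2 Y p + lie Z1 Y' p).
  by rewrite -(lieNl s2 sY') -(lieNl s2 sY); move: ET; rewrite !differential_id.
have ker l : (l = Z1 \/ l = Z2) -> forall W, smooth_vf_at p W ->
    (\forall q \near p, a1 q (W q) = 0) -> (\forall q \near p, a2 q (W q) = 0) ->
    a1 p (lie l W p) = 0 /\ a2 p (lie l W p) = 0.
  have R1 q : extd a1 (Z1 q) =1 fun=> 0.
    by move=> u; have [_ _ _ _ H] := mcp_reeb q; have [] := H u.
  have R2 q : extd a2 (Z1 q) =1 fun=> 0.
    by move=> u; have [_ _ _ _ H] := mcp_reeb q; have [] := H u.
  have R3 q : extd a1 (Z2 q) =1 fun=> 0.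
    by move=> u; have [_ _ _ _ H] := mcp_reeb q; have [] := H u.
  have R4 q : extd a2 (Z2 q) =1 fun=> 0.
    by move=> u; have [_ _ _ _ H] := mcp_reeb q; have [] := H u.
  move=> [] -> W sW W1 W2; split.
  - apply: (reeb_lie_ker mcp_form1 mcp_smooth1 R1) => //.
    by exists 1 => q; have [] := mcp_reeb q.
  - apply: (reeb_lie_ker mcp_form2 mcp_smooth1 R2) => //.
    by exists 0 => q; have [] := mcp_reeb q.
  - apply: (reeb_lie_ker mcp_form1 mcp_smooth2 R3) => //.
    by exists 0 => q; have [] := mcp_reeb q.
  - apply: (reeb_lie_ker mcp_form2 mcp_smooth2 R4) => //.
    by exists 1 => q; have [] := mcp_reeb q.
have Y1' : \forall q \near p, a1 q (Y' q) = 0.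
  by apply: nearW => q; exact: mcp_a1phi.
have Y2' : \forall q \near p, a2 q (Y' q) = 0.
  by apply: nearW => q; exact: mcp_a2phi.
have [A1 A2] := ker Z1 (or_introl erefl) Y sY Y1 Y2.
have [A1' A2'] := ker Z1 (or_introl erefl) Y' sY' Y1' Y2'.
have [B1 B2] := ker Z2 (or_intror erefl) Y sY Y1 Y2.
move: EJ ET A1 A2 A1' A2' B1 B2; rewrite /=.
set A := lie Z1 Y p; set A' := lie Z1 Y' p; set B := lie Z2 Y p; set B' := lie Z2 Y' p.
move=> EJ ET A1 A2 A1' A2' B1 B2; move: EJ ET.
rewrite !(one_formD mcp_form1, one_formD mcp_form2, one_formN mcp_form1, one_formN mcp_form2).
rewrite A1' A2' B1 B2 !oppr0 !addr0 !scale0r !subr0 !addr0.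
rewrite !mcp_phiD !mcp_phiN => EJ ET.
have two0 (u : tangent p) : u *+ 2 = 0 -> u = 0.
  by move/eqP; rewrite -scaler_nat scaler_eq0 pnatr_eq0 => /eqP.
have EB : B' = phi p B.
  apply/eqP; rewrite -subr_eq0; apply/eqP/two0.
  have -> : (B' - phi p B) *+ 2 =
     (B' - A - (phi p B + phi p A')) - (- B' - A - (- phi p B + phi p A')).
    by apply: tangent_ext => f sf; rewrite mulr2n !(tangentDE, tangentNE); ring.
  by rewrite EJ ET !subrr.
have EA : A = - phi p A'.
  by move: EJ; rewrite EB => /addrI <-; rewrite opprK.
split=> //; rewrite EA mcp_phiN mcp_phi2 A1' A2' !scale0r !addr0.
by rewrite opprK.
Qed.

(** * The unit field zeta of an invariant submanifold *)

Section Submanifold.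
Context {n : nat} {N : manifold R n} (i : N -> M).
Hypothesis sub : submanifold i.
Hypothesis inv : phi_invariant i phi.
Hypothesis not_tangent : nowhere_tangent i Z1.
Hypothesis not_orthogonal : nowhere_orthogonal i g Z1.

Local Notation di := (differential i).
Local Notation phiN := (induced_endo i phi).
Local Notation gN := (induced_metric i g).
Local Notation Ztan := (tangential_part i g Z1).
Local Notation zeta := (normalized gN Ztan).
Local Notation omega := (dual_form gN zeta).

Lemma sub_smooth : smooth_map i. Proof. by case: sub. Qed.
Lemma sub_inj p : injective (@differential R m n N M i p). Proof. by case: sub. Qed.

Let sI := sub_smooth.
Let rg := mcp_riemannian.

Lemma phiNE p (u : tangent p) : di (phiN u) = phi (i p) (di u).
Proof.
rewrite /induced_endo; apply: (@xgetPex _ 0 [set v | di v = phi (i p) (di u)]).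
by have [v _ Ev] := inv (ex_intro2 _ _ (di u) (imageT _ u) erefl); exists v.
Qed.

Lemma di_eq0 p (u : tangent p) : di u = 0 -> u = 0.
Proof. by move=> u0; apply: (@sub_inj p); rewrite u0 differential0. Qed.

(** Fields along N do not extend to M in general; their products are smooth
    because their components in ambient frames are. *)
Lemma smooth_product_along p (I J : finType) (b : I -> N -> R) (d : J -> N -> R)
    (A : I -> vfield M) (B : J -> vfield M) (f : N -> R) :
  (forall a, smooth_at p (b a)) -> (forall a, smooth_at p (d a)) ->
  (forall a, smooth_vf_at (i p) (A a)) -> (forall a, smooth_vf_at (i p) (B a)) ->
  (\forall q \near p, f q =
     g (i q) (\sum_a b a q *: A a (i q)) (\sum_a d a q *: B a (i q))) ->
  smooth_at p f.
Proof.
move=> sb sd sA sB Hf; have [_ _ _ sg] := rg.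
apply: (@smooth_at_near_eq _ _ _ _ (fun q =>
  \sum_a \sum_e b a q * (d e q * g (i q) (A a (i q)) (B e (i q))))).
  apply: filterS Hf => q ->; rewrite (riemannian_suml rg); apply: eq_bigr => a _.
  rewrite (riemannian_sumr rg); apply: eq_bigr => e _.
  by rewrite (riemannianZl rg) (riemannianZr rg).
apply: smooth_at_sum => a _; apply: smooth_at_sum => e _.
apply: smooth_atM => //; apply: smooth_atM => //.
by apply: (smooth_at_comp sI (f := fun r => g r (A a r) (B e r))); exact: sg.
Qed.

Lemma gN_riemannian : riemannian gN.
Proof.
split.
- move=> p u b v w; rewrite /induced_metric (differentialD sI) (differentialZ sI).
  by rewrite (riemannianDr rg) (riemannianZr rg).
- by move=> p u v; exact: (riemannian_sym rg).
- move=> p u u0; apply: (riemannian_gt0 rg).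
  by apply: contra_neq u0; exact: di_eq0.
- move=> p X Y sX sY; have [c ac cp] := chart_at (i p).
  have [_ sc sA XA] := along_frame sI ac cp sX.
  have [_ sd sB YB] := along_frame sI ac cp sY.
  by apply: (smooth_product_along sc sd sA sB); apply: filterS2 XA YB => q <- <-.
Qed.

Let rN := gN_riemannian.

Lemma smooth_phiN p X : smooth_vf_at p X -> smooth_vf_at p (fun q => phiN (X q)).
Proof.
move=> sX; apply: (smooth_vf_riemannian rN) => Y sY.
have [c ac cp] := chart_at (i p).
have [_ sc sA XA] := along_frame sI ac cp sX.
have [_ sd sB YB] := along_frame sI ac cp sY.
apply: (smooth_product_along sc sd (A := fun a r => phi r (dcoord c a r)) _ sB).
  by move=> a; apply: mcp_tensor.2; exact: sA.
apply: filterS2 XA YB => q XAq <-; rewrite /induced_metric phiNE XAq.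
congr (g _ _ _); rewrite (big_morph _ (@mcp_phiD (i q)) (mcp_phi0 (i q))).
by apply: eq_bigr => a _; rewrite mcp_phiZ.
Qed.

Lemma phiN_linear p : linear (@induced_endo R m n N M i phi p).
Proof.
move=> b u v; apply: (@sub_inj p).
by rewrite !(phiNE, differentialD sI, differentialZ sI) mcp_phiD mcp_phiZ.
Qed.

Lemma ZtanE p (u : tangent p) : gN (Ztan p) u = a1 (i p) (di u).
Proof.
have E : forall u : tangent p, g (i p) (Z1 (i p) - di (Ztan p)) (di u) = 0.
  rewrite /tangential_part.
  apply: (@xgetPex _ 0 [set v | forall u : tangent p,
    g (i p) (Z1 (i p) - di v) (di u) = 0]).
  have [|v Hv] := @riesz _ _ _ _ rN p (fun u => g (i p) (Z1 (i p)) (di u)).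
    move=> b v w; rewrite (differentialD sI) (differentialZ sI).
    by rewrite (riemannianDr rg) (riemannianZr rg).
  exists v => w; rewrite (riemannianDl rg) (riemannianNl rg).
  by have := Hv w; rewrite /induced_metric => ->; rewrite subrr.
have := E u; rewrite (riemannianDl rg) (riemannianNl rg) => /eqP.
by rewrite subr_eq0 (riemannian_sym rg (Z1 _)) mcp_gZ1 => /eqP ->.
Qed.

Lemma Ztan_neq0 p : Ztan p != 0.
Proof.
apply/eqP => t0; apply: (not_orthogonal (p := p)) => u.
rewrite (riemannian_sym rg) mcp_gZ1 -ZtanE t0 (riemannian_sym rN).
exact: (riemannian0r rN).
Qed.

Lemma Ztan_gt0 p : 0 < gN (Ztan p) (Ztan p).
Proof. exact: (riemannian_gt0 rN (Ztan_neq0 p)). Qed.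

(** As phi is skew and preserves the tangent spaces of N, it commutes with the
    projection onto them, and it kills Z1. *)
Lemma phi_Ztan p : phi (i p) (di (Ztan p)) = 0.
Proof.
rewrite -phiNE; suff -> : phiN (Ztan p) = 0 by rewrite (differential0 sI).
apply: (riemannian_eq0 rN); rewrite {1}/induced_metric phiNE.
rewrite -[LHS]opprK -mcp_phi_skew -!phiNE.
rewrite -[g _ _ _]/(gN (Ztan p) (phiN (phiN (Ztan p)))) ZtanE.
by rewrite phiNE mcp_a1phi oppr0.
Qed.

(** The kernel of phi is spanned by the orthonormal fields Z1 and Z2; these
    functions on N are the coordinates of zeta in that plane. *)
Definition cosine (p : N) : R := a1 (i p) (di (zeta p)).
Definition sine (p : N) : R := a2 (i p) (di (zeta p)).

Lemma phi_zeta p : phi (i p) (di (zeta p)) = 0.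
Proof. by rewrite /normalized (differentialZ sI) mcp_phiZ phi_Ztan scaler0. Qed.

Lemma zetaE p : di (zeta p) = cosine p *: Z1 (i p) + sine p *: Z2 (i p).
Proof.
have := mcp_phi2 (di (zeta p)); rewrite phi_zeta mcp_phi0 -addrA => /esym/eqP.
by rewrite addrC addr_eq0 opprK => /eqP <-.
Qed.

Lemma omega_zeta p : omega (zeta p) = 1.
Proof.
rewrite /dual_form /normalized (riemannianZl rN) (riemannianZr rN) mulrA.
by rewrite -expr2 exprVn sqr_sqrtr ?(ltW (Ztan_gt0 p)) // mulVf // gt_eqF // Ztan_gt0.
Qed.

Lemma omegaE p (u : tangent p) :
  omega u = cosine p * a1 (i p) (di u) + sine p * a2 (i p) (di u).
Proof.
rewrite /dual_form /induced_metric zetaE (riemannianDl rg) !(riemannianZl rg).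
by rewrite !(riemannian_sym rg _ (di u)) mcp_gZ1 mcp_gZ2.
Qed.

Lemma a1E p (u : tangent p) : a1 (i p) (di u) = cosine p * omega u.
Proof.
pose t := Num.sqrt (gN (Ztan p) (Ztan p)).
have t0 : t != 0 by rewrite gt_eqF // sqrtr_gt0 Ztan_gt0.
have H v : a1 (i p) (di v) = t * omega v.
  by rewrite /dual_form /normalized (riemannianZl rN) mulVKf // ZtanE.
by rewrite /cosine !H omega_zeta mulr1.
Qed.

Lemma cosine_gt0 p : 0 < cosine p.
Proof.
rewrite /cosine -ZtanE /normalized (riemannianZr rN) mulr_gt0 ?Ztan_gt0 //.
by rewrite invr_gt0 sqrtr_gt0 Ztan_gt0.
Qed.

Lemma circle p : cosine p ^+ 2 + sine p ^+ 2 = 1.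
Proof.
by have := omegaE (zeta p); rewrite omega_zeta -/(cosine p) -/(sine p) !expr2.
Qed.

Lemma sine_neq0 p : sine p != 0.
Proof.
apply/eqP => s0; apply: (not_tangent (p := p)); exists ((cosine p)^-1 *: zeta p) => //.
have c0 : cosine p != 0 by rewrite gt_eqF // cosine_gt0.
by rewrite (differentialZ sI) zetaE s0 scale0r addr0 scalerA mulVf // scale1r.
Qed.

(** Since zeta is a unit vector, sine times this identity follows from the one for
    a1; and sine does not vanish because Z1 is nowhere tangent. *)
Lemma a2E p (u : tangent p) : a2 (i p) (di u) = sine p * omega u.
Proof.
apply: (mulfI (sine_neq0 p)); rewrite mulrA -expr2.
have -> : sine p ^+ 2 = 1 - cosine p ^+ 2 by rewrite -(circle p); ring.
by have := omegaE u; rewrite a1E => H; rewrite mulrBl mul1r {1}H; ring.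
Qed.

Lemma smooth_zeta : smooth_vf zeta.
Proof.
have sa : one_form (pullback i a1) := pullback_one_form sI mcp_form1.
have st p : smooth_vf_at p Ztan.
  apply: (smooth_vf_riemannian rN) => Y sY.
  rewrite (_ : (fun q => gN (Ztan q) (Y q)) = fun q => pullback i a1 (Y q)).
    exact: sa.2.
  by apply/funext => q; rewrite ZtanE.
move=> p; apply: smooth_vfZ; last exact: st.
apply: smooth_atV; first by rewrite gt_eqF // sqrtr_gt0 Ztan_gt0.
apply: smooth_at_sqrt; first exact: Ztan_gt0.
by have [_ _ _ +] := rN; apply; exact: st.
Qed.

Lemma omega_one_form : one_form omega.
Proof.
split=> [p b u v|p X sX].
  by rewrite /dual_form (riemannianDr rN) (riemannianZr rN).
by have [_ _ _ +] := rN; apply => //; exact: smooth_zeta.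
Qed.

Lemma smooth_cosine p : smooth_at p cosine.
Proof. by apply: (pullback_one_form sI mcp_form1).2; exact: smooth_zeta. Qed.

Lemma smooth_sine p : smooth_at p sine.
Proof. by apply: (pullback_one_form sI mcp_form2).2; exact: smooth_zeta. Qed.

Lemma extd_a1_zeta p (v : tangent p) : extd a1 (di (zeta p)) (di v) = 0.
Proof.
have [_ _ _ _ H] := mcp_reeb (i p); have [H1 _ H2 _] := H (di v).
rewrite zetaE (extdDl _ _ _ mcp_form1) !(extdZl _ _ _ mcp_form1) H1 H2.
by rewrite !mulr0 addr0.
Qed.

Lemma extd_a2_zeta p (v : tangent p) : extd a2 (di (zeta p)) (di v) = 0.
Proof.
have [_ _ _ _ H] := mcp_reeb (i p); have [_ H1 _ H2] := H (di v).
rewrite zetaE (extdDl _ _ _ mcp_form2) !(extdZl _ _ _ mcp_form2) H1 H2.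
by rewrite !mulr0 addr0.
Qed.

Lemma extd_a1 p (u v : tangent p) : 2 * extd a1 (di u) (di v) =
  u cosine * omega v - v cosine * omega u + 2 * (cosine p * extd omega u v).
Proof.
rewrite -(extd_pullback sI u v mcp_form1).
apply: (extd_mulf u v (pullback_one_form sI mcp_form1) omega_one_form
  (@smooth_cosine p)).
by move=> q w; rewrite /pullback a1E.
Qed.

Lemma extd_a2 p (u v : tangent p) : 2 * extd a2 (di u) (di v) =
  u sine * omega v - v sine * omega u + 2 * (sine p * extd omega u v).
Proof.
rewrite -(extd_pullback sI u v mcp_form2).
apply: (extd_mulf u v (pullback_one_form sI mcp_form2) omega_one_form
  (@smooth_sine p)).
by move=> q w; rewrite /pullback a2E.
Qed.

Lemma der_circle p (u : tangent p) : cosine p * u cosine + sine p * u sine = 0.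
Proof.
have sc := @smooth_cosine p; have ss := @smooth_sine p.
have : u (fun q => cosine q * cosine q + sine q * sine q) = 0.
  rewrite -(der_cst u 1); congr (tangent_val u _); apply/funext => q.
  by rewrite -!expr2 circle.
rewrite derD; [|exact: smooth_atM|exact: smooth_atM].
rewrite !derM // => H; apply: (mulfI (two_neq0 (R := R))); rewrite mulr0 -H; ring.
Qed.

(** Both da1 and da2 vanish on zeta. In the combination of these two equations with
    coefficients cosine and sine, only d omega (zeta, v) survives, because
    cosine * d cosine + sine * d sine = 0. *)
Lemma extd_omega_zeta p (v : tangent p) : extd omega (zeta p) v = 0.
Proof.
have H1 := extd_a1 (zeta p) v; have H2 := extd_a2 (zeta p) v.
rewrite extd_a1_zeta mulr0 omega_zeta in H1.
rewrite extd_a2_zeta mulr0 omega_zeta in H2.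
have Dz := der_circle (zeta p); have Dv := der_circle v.
apply: (mulfI (two_neq0 (R := R))); rewrite mulr0.
transitivity (2 * (cosine p ^+ 2 + sine p ^+ 2) * extd omega (zeta p) v).
  by rewrite circle mulr1.
have combine (c s zc zs vc vs o d : R) : 2 * (c ^+ 2 + s ^+ 2) * d =
    c * (zc * o - vc * 1 + 2 * (c * d)) + s * (zs * o - vs * 1 + 2 * (s * d))
    - (c * zc + s * zs) * o + (c * vc + s * vs) by ring.
rewrite (combine _ _ (zeta p cosine) (zeta p sine) (v cosine) (v sine) (omega v)).
by rewrite -H1 -H2 Dz Dv mul0r !mulr0 subr0 !addr0.
Qed.

Lemma der_cosine p (v : tangent p) : v cosine = zeta p cosine * omega v.
Proof.
have := extd_a1 (zeta p) v; rewrite extd_a1_zeta extd_omega_zeta omega_zeta.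
rewrite !mulr0 addr0 mulr1 => /esym/eqP.
by rewrite subr_eq0 => /eqP.
Qed.

Lemma der_sine p (v : tangent p) : v sine = zeta p sine * omega v.
Proof.
have := extd_a2 (zeta p) v; rewrite extd_a2_zeta extd_omega_zeta omega_zeta.
rewrite !mulr0 addr0 mulr1 => /esym/eqP.
by rewrite subr_eq0 => /eqP.
Qed.

(** The differentials of cosine and sine are multiples of omega, so their wedge
    products with omega vanish: da1 = cosine d omega and da2 = sine d omega on N. *)
Lemma gN_phiN p (u v : tangent p) :
  gN u (phiN v) = (cosine p + sine p) * extd omega u v.
Proof.
rewrite /induced_metric phiNE mcp_gphi.
apply: (mulfI (two_neq0 (R := R))); rewrite mulrDr extd_a1 extd_a2.
rewrite (der_cosine u) (der_cosine v) (der_sine u) (der_sine v).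
have combine (c s zc zs ou ov d : R) :
    zc * ou * ov - zc * ov * ou + 2 * (c * d) +
    (zs * ou * ov - zs * ov * ou + 2 * (s * d)) = 2 * ((c + s) * d) by ring.
exact: combine.
Qed.

Lemma phiN_skew p (u v : tangent p) : gN u (phiN v) = - gN (phiN u) v.
Proof. by rewrite /induced_metric !phiNE mcp_phi_skew. Qed.

Lemma phiN2 p (u : tangent p) : phiN (phiN u) = - u + omega u *: zeta p.
Proof.
apply: (@sub_inj p); rewrite (differentialD sI) (differentialN sI) (differentialZ sI).
rewrite !phiNE mcp_phi2 a1E a2E zetaE scalerDr !scalerA -addrA.
by rewrite ![_ * omega u]mulrC.
Qed.

Lemma phiN_zeta p : phiN (zeta p) = 0.
Proof. by apply: (@sub_inj p); rewrite phiNE phi_zeta (differential0 sI). Qed.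

Lemma omega_phiN p (u : tangent p) : omega (phiN u) = 0.
Proof. by rewrite omegaE phiNE mcp_a1phi mcp_a2phi !mulr0 addr0. Qed.

Lemma zeta_norm p : gN (zeta p) (zeta p) = 1. Proof. exact: omega_zeta. Qed.

Lemma gN_scalar p (u : tangent p) : scalar (gN u).
Proof. by case: rN. Qed.

Lemma frame_exists p : exists2 l, n = (1 + l * 2)%N &
  exists e, phi_frame (fun u v : tangent p => gN u v) (fun u => phiN u) (zeta p) l e.
Proof.
apply: (@phi_frame_exists R n N p (fun u v => gN u v) (fun u => phiN u) (zeta p)).
- exact: gN_scalar.
- by move=> u v; exact: (riemannian_sym rN).
- by move=> u; exact: (riemannian_gt0 rN).
- exact: phiN_skew.
- exact: phiN2.
- exact: zeta_norm.
- exact: phiN_zeta.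
Qed.

(** * Normality on the submanifold *)

Lemma near_ker (p : N) (X : vfield N) : (\forall q \near p, omega (X q) = 0) ->
  \forall q \near p, a1 (i q) (di (X q)) = 0 /\ a2 (i q) (di (X q)) = 0.
Proof. by apply: filterS => q X0; rewrite a1E a2E X0 !mulr0. Qed.

Lemma phiN_tensor : tensor11 phiN.
Proof. by split; [exact: phiN_linear|exact: smooth_phiN]. Qed.

(** On the kernel of omega, acsJ and acsT both restrict to the induced phi; half the
    sum of their integrability conditions, read along i, is the required identity
    up to the component omega [X, Y] = - 2 d omega (X, Y). *)
Lemma nijenhuis_horizontal (p : N) (X Y : vfield N) : normal_contact_pair a1 a2 Z1 Z2 phi ->
  smooth_vf_at p X -> smooth_vf_at p Y ->
  (\forall q \near p, omega (X q) = 0) -> (\forall q \near p, omega (Y q) = 0) ->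
  nijenhuis phiN X Y p + (2 * extd omega (X p) (Y p)) *: zeta p = 0.
Proof.
move=> [iJ iT] sX sY X0 Y0.
pose X' : vfield N := fun q => phiN (X q); pose Y' : vfield N := fun q => phiN (Y q).
have sX' : smooth_vf_at p X' by exact: smooth_phiN.
have sY' : smooth_vf_at p Y' by exact: smooth_phiN.
have EJ := @integrable_along _ _ _ N M i sI acsJ p X Y X' Y' iJ.
have ET := @integrable_along _ _ _ N M i sI acsT p X Y X' Y' iT.
have KJ (V : vfield N) : (\forall q \near p, omega (V q) = 0) -> \forall q \near p,
    di (phiN (V q)) = phi (i q) (di (V q)) - a2 (i q) (di (V q)) *: Z1 (i q) +
      a1 (i q) (di (V q)) *: Z2 (i q).
  by move/near_ker; apply: filterS => q [-> ->]; rewrite !scale0r subr0 addr0 phiNE.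
have KT (V : vfield N) : (\forall q \near p, omega (V q) = 0) -> \forall q \near p,
    di (phiN (V q)) = phi (i q) (di (V q)) + a2 (i q) (di (V q)) *: Z1 (i q) -
      a1 (i q) (di (V q)) *: Z2 (i q).
  by move/near_ker; apply: filterS => q [-> ->]; rewrite !scale0r subr0 addr0 phiNE.
have {}EJ := EJ (And4 sX sY sX' sY') (KJ _ X0) (KJ _ Y0).
have {}ET := ET (And4 sX sY sX' sY') (KT _ X0) (KT _ Y0).
have ext : extd omega (X p) (Y p) *+ 2 = - omega (lie X Y p).
  rewrite -mulr_natl extdE //; last exact: omega_one_form.
  rewrite /cartan (der_near (X p) _ Y0); last by apply: omega_one_form.2.
  rewrite (der_near (Y p) _ X0); last by apply: omega_one_form.2.
  by rewrite !der_cst subrr sub0r.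
pose W := lie X' Y p + lie X Y' p.
have E : lie X' Y' p - lie X Y p = phiN W.
  apply: (@sub_inj p); rewrite phiNE -/W in EJ ET *.
  apply: (scalerI (two_neq0 (R := R))).
  rewrite !scaler_nat [LHS]mulr2n {1}EJ ET.
  by apply: tangent_ext => f sf; rewrite mulr2n !(tangentDE, tangentNE); ring.
have -> : nijenhuis phiN X Y p = phiN (phiN (lie X Y p)) + lie X' Y' p - phiN W.
  rewrite /nijenhuis /W; have := phiN_linear 1 (lie X' Y p) (lie X Y' p).
  by rewrite !scale1r => ->; rewrite opprD addrA.
rewrite -E phiN2 mulr_natl ext scaleNr.
by apply: tangent_ext => f sf; rewrite !(tangentDE, tangentNE) tangent0E; ring.
Qed.

Lemma along_zeta p : along i p zeta (fun (b : bool) => if b then cosine else sine)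
  (fun b => if b then Z1 else Z2).
Proof.
split.
- exact: smooth_zeta.
- by case; [exact: smooth_cosine|exact: smooth_sine].
- by case; [exact: mcp_smooth1|exact: mcp_smooth2].
- by apply: nearW => q; rewrite big_bool /= zetaE.
Qed.

(** As acsJ zeta is normal to N, integrability cannot be read along i here. Instead the
    invariance of phi under Z1 and Z2 is carried over to N: Y and its image under
    phi have the same coefficients y in the frames E and phi E, where E spans
    the common kernel of a1 and a2, and cosine and sine are constant along both. *)
Lemma lie_zeta_phiN (p : N) (Y : vfield N) : normal_contact_pair a1 a2 Z1 Z2 phi ->
  smooth_vf_at p Y -> (\forall q \near p, omega (Y q) = 0) ->
  lie zeta (fun q => phiN (Y q)) p = phiN (lie zeta Y p).
Proof.
move=> nor sY Y0; have [c ac cp] := chart_at (i p).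
have [_ sc sE YE] := along_frame sI ac cp sY.
set y := (fun a q => Y q (fun r => c (i r) 0 a)) in sc YE.
pose E a r := dcoord c a r - a1 r (dcoord c a r) *: Z1 r - a2 r (dcoord c a r) *: Z2 r.
have sE' a : smooth_vf_at (i p) (E a).
  apply: smooth_vfB; first apply: smooth_vfB => //.
  - by apply: smooth_vfZ; [apply: mcp_form1.2|exact: mcp_smooth1].
  - by apply: smooth_vfZ; [apply: mcp_form2.2|exact: mcp_smooth2].
have E1 a r : a1 r (E a r) = 0.
  rewrite /E !(one_formD mcp_form1, one_formN mcp_form1, one_formZ mcp_form1).
  by have [-> -> _ _ _] := mcp_reeb r; ring.
have E2 a r : a2 r (E a r) = 0.
  rewrite /E !(one_formD mcp_form2, one_formN mcp_form2, one_formZ mcp_form2).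
  by have [_ _ -> -> _] := mcp_reeb r; ring.
have AY : along i p Y y E.
  split=> //; apply: filterS2 (near_ker Y0) YE => q [Y1 Y2] EY.
  rewrite EY in Y1 Y2 *; rewrite (one_form_sum mcp_form1) in Y1.
  rewrite (one_form_sum mcp_form2) in Y2.
  have -> : \sum_a y a q *: E a (i q) = \sum_a y a q *: dcoord c a (i q)
      - (\sum_a a1 (i q) (y a q *: dcoord c a (i q))) *: Z1 (i q)
      - (\sum_a a2 (i q) (y a q *: dcoord c a (i q))) *: Z2 (i q).
    rewrite !scaler_suml -!sumrB; apply: eq_bigr => a _.
    rewrite (one_formZ mcp_form1) (one_formZ mcp_form2) /E !scalerBr !scalerA.
    by [].
  by rewrite Y1 Y2 !scale0r !subr0.
have AY' : along i p (fun q => phiN (Y q)) y (fun a r => phi r (E a r)).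
  split=> //; first exact: smooth_phiN.
    by move=> a; apply: mcp_tensor.2.
  have [_ _ _ EY] := AY; apply: filterS EY => q EY.
  rewrite phiNE EY (big_morph _ (@mcp_phiD (i q)) (mcp_phi0 (i q))).
  by apply: eq_bigr => a _; rewrite mcp_phiZ.
apply: (@sub_inj p); rewrite phiNE (lie_along sI (along_zeta p) AY).
rewrite (lie_along sI (along_zeta p) AY') !big_bool /=.
have Y0p := nbhs_singleton Y0; rewrite /= in Y0p.
rewrite (der_cosine (Y p)) (der_sine (Y p)) Y0p.
rewrite (der_cosine (phiN (Y p))) (der_sine (phiN (Y p))) omega_phiN.
rewrite !mulr0 !scale0r addr0 !subr0 !mcp_phiD.
congr (_ + (_ + _)); rewrite (big_morph _ (@mcp_phiD (i p)) (mcp_phi0 (i p)));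
  apply: eq_bigr => a _; rewrite mcp_phiZ //; congr (_ *: _).
- by apply: (reeb_lie_phi nor _ _ _).1 => //; apply: nearW => r.
- by apply: (reeb_lie_phi nor _ _ _).2 => //; apply: nearW => r.
Qed.

Lemma nijenhuis_zeta (p : N) (Y : vfield N) : normal_contact_pair a1 a2 Z1 Z2 phi ->
  smooth_vf_at p Y -> (\forall q \near p, omega (Y q) = 0) ->
  nijenhuis phiN zeta Y p = 0.
Proof.
move=> nor sY Y0; rewrite /nijenhuis.
have -> : (fun q => phiN (zeta q)) = (fun q => 0 : tangent q).
  by apply: functional_extensionality_dep => q; rewrite phiN_zeta.
have p0 : phiN (0 : tangent p) = 0.
  by have := phiN_linear (-1) (0 : tangent p) 0; rewrite !scaleN1r !addNr.
rewrite !lie0l //; last exact: smooth_phiN.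
by rewrite lie_zeta_phiN // p0 addr0 subr0 subrr.
Qed.

Lemma induced_normal : normal_contact_pair a1 a2 Z1 Z2 phi ->
  normal_almost_contact phiN zeta omega.
Proof.
move=> nor X Y sX sY p; have fo := omega_one_form.
rewrite (nijenhuis_split phiN_tensor smooth_zeta fo (sX p) (sY p)).
set X0 := (fun q => X q - _); set Y0 := (fun q => Y q - _).
have s0 (V : vfield N) : smooth_vf V -> smooth_vf_at p (fun q => V q - omega (V q) *: zeta q).
  move=> sV; apply: smooth_vfB => //; apply: smooth_vfZ; last exact: smooth_zeta.
  by apply: fo.2.
have o0 (V : vfield N) : \forall q \near p, omega (V q - omega (V q) *: zeta q) = 0.
  apply: nearW => q; rewrite (one_formD fo) (one_formN fo) (one_formZ fo) omega_zeta.
  by rewrite mulr1 subrr.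
rewrite !nijenhuis_zeta //; [|exact: s0|exact: o0|exact: s0|exact: o0].
rewrite !scaler0 subr0 addr0.
have <- : extd omega (X0 p) (Y0 p) = extd omega (X p) (Y p).
  rewrite /X0 /Y0 -!scaleNr (extdDl _ _ _ fo) (extdZl _ _ _ fo) extd_omega_zeta mulr0 addr0.
  rewrite (extdDr _ _ _ fo) (extdZr _ _ _ fo) (extd_anti _ (zeta p) fo).
  by rewrite extd_omega_zeta oppr0 mulr0 addr0.
by apply: nijenhuis_horizontal => //; [exact: s0|exact: s0|exact: o0|exact: o0].
Qed.

(** * The induced contact form *)

Lemma induced_almost_contact (p0 : N) : almost_contact_metric phiN zeta omega gN.
Proof.
split.
- by have [l nl _] := frame_exists p0; rewrite nl oddD oddM andbF.
- split; [exact: phiN_tensor|exact: smooth_zeta|exact: omega_one_form|exact: rN].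
- move=> p u v; split.
  + exact: phiN2.
  + exact: omega_zeta.
  + exact: phiN_zeta.
  + exact: omega_phiN.
  + exact: (g_phi_phi (@gN_scalar p) (riemannian_sym rN (p := p)) (@phiN_skew p) (@phiN2 p)).
Qed.

(** This identity excludes both cosine + sine = 0 and, through
    cosine ^+ 2 + sine ^+ 2 = 1, the contact metric condition. *)
Lemma extd_omegaE p (e : tangent p) : gN e e = 1 -> omega e = 0 ->
  (cosine p + sine p) * extd omega (phiN e) e = 1.
Proof.
move=> e1 e0; rewrite -gN_phiN.
rewrite (g_phi_phi (@gN_scalar p) (riemannian_sym rN (p := p)) (@phiN_skew p) (@phiN2 p)).
by rewrite e1 -/(omega e) e0 mul0r subr0.
Qed.

Hypothesis n3 : (3 <= n)%N.

Lemma unit_horizontal p : exists2 e : tangent p, gN e e = 1 & omega e = 0.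
Proof.
have [l nl [e fe]] := frame_exists p.
have l0 : (0 < l)%N by lia.
by exists (e 0%N); have [] := fe _ _ l0 l0.
Qed.

Lemma cos_sin_neq0 p : cosine p + sine p != 0.
Proof.
have [e e1 e0] := unit_horizontal p; apply/eqP => cs0.
by have /eqP := extd_omegaE e1 e0; rewrite cs0 mul0r eq_sym oner_eq0.
Qed.

Lemma induced_not_contact_metric (p : N) : ~ contact_metric phiN zeta omega gN.
Proof.
move=> [_ H]; have [e e1 e0] := unit_horizontal p.
have := extd_omegaE e1 e0; have [_ <-] := H p (phiN e) e.
rewrite (g_phi_phi (@gN_scalar p) (riemannian_sym rN (p := p)) (@phiN_skew p) (@phiN2 p)).
rewrite e1 -/(omega e) e0 mul0r subr0 mulr1 => cs1.
have : 2 * (cosine p * sine p) = 0.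
  have -> : 2 * (cosine p * sine p) = (cosine p + sine p) ^+ 2 -
    (cosine p ^+ 2 + sine p ^+ 2) by ring.
  by rewrite circle cs1; ring.
move/eqP; rewrite !mulf_eq0 pnatr_eq0 /= (negbTE (sine_neq0 p)) orbF.
by rewrite gt_eqF // cosine_gt0.
Qed.

(** Up to the factor cosine + sine, d omega is the fundamental form of the induced
    almost contact metric structure. *)
Lemma frame_symplectic p l e :
  phi_frame (fun u v : tangent p => gN u v) (fun u => phiN u) (zeta p) l e ->
  symplectic_family (extd omega) (- (cosine p + sine p)^-1)
    (fun x : 'I_(l * 2) => frame_vec (fun u => phiN u) (zeta p) e (rshift 1 x)).
Proof.
move=> fe x y; have cs0 := cos_sin_neq0 p.
have dE (u v : tangent p) : extd omega u v = (cosine p + sine p)^-1 * gN u (phiN v).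
  by rewrite gN_phiN mulKf.
have [xl yl] : (x./2 < l)%N /\ (y./2 < l)%N.
  by have := ltn_ord x; have := ltn_ord y; lia.
have [z1 xy1 xp] := fe _ _ xl yl; have [z2 xy2 yp] := fe _ _ yl xl.
rewrite dE /=; have xE := odd_double_half x; have yE := odd_double_half y.
have gpp := g_phi_phi (@gN_scalar p) (riemannian_sym rN (p := p)) (@phiN_skew p) (@phiN2 p).
have oz : omega (e y./2) = 0 by [].
case ox: (odd x); case oy: (odd y); rewrite ox oy in xE yE.
- rewrite phiN2 oz scale0r addr0 (riemannianNr rN) (riemannian_sym rN) yp oppr0 mulr0.
  by case: eqP => // xy; rewrite -xE -yE xy !ltnn.
- rewrite gpp z1 mul0r subr0 xy1; case: eqP => xy /=; last by rewrite mulr0.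
  by rewrite -xE -yE xy /= add0n add1n ltnNge leqnSn ltnSn opprK mulr1.
- rewrite phiN2 oz scale0r addr0 (riemannianNr rN) xy1; case: eqP => xy /=.
    by rewrite -xE -yE xy /= add0n add1n ltnSn mulrN mulr1.
  by rewrite oppr0 mulr0.
- rewrite xp mulr0; case: eqP => // xy; by rewrite -xE -yE xy !ltnn.
Qed.

Lemma induced_contact_form (p0 : N) : contact_form omega.
Proof.
split; first exact: omega_one_form.
have [l nl _] := frame_exists p0; exists l; split; first by rewrite nl.
move=> p; have [l' nl' [e fe]] := frame_exists p.
have El : l' = l by lia.
rewrite {}El in fe.
exists (fun x => frame_vec (fun u => phiN u) (zeta p) e x).
apply: (contact_volume_neq0 _ _ (frame_symplectic fe)).
  by rewrite oppr_eq0 invr_neq0 // cos_sin_neq0.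
move=> x; rewrite -[omega _]/(gN (zeta p) (frame_vec _ _ e x)).
have := @frame_vec_orthonormal _ _ _ p _ _ _ (@gN_scalar p) (riemannian_sym rN (p := p))
  (@phiN_skew p) (@phiN2 p) (@zeta_norm p) (@phiN_zeta p) l e 0%N x fe.
by rewrite eq_sym; apply => //; exact: ltn_ord.
Qed.

Lemma induced_reeb : reeb_field omega zeta.
Proof.
split=> [|p]; first exact: smooth_zeta.
by split; [exact: omega_zeta|exact: extd_omega_zeta].
Qed.

End Submanifold.
End MetricContactPair.

Unset Implicit Arguments.

Theorem theorem18 (R : realType) (h k m n : nat)
    (M : manifold R m) (a1 a2 : covector_field M) (Z1 Z2 : vfield M)
    (phi : endo_field M) (g : bilin_field M)
    (N : manifold R n) (i : N -> M) :
  metric_contact_pair h k a1 a2 Z1 Z2 phi g ->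
  decomposable a1 a2 phi ->
  submanifold i ->
  [set: N] !=set0 ->
  (3 <= n)%N ->
  phi_invariant i phi ->
  nowhere_tangent i Z1 -> nowhere_tangent i Z2 ->
  nowhere_orthogonal i g Z1 -> nowhere_orthogonal i g Z2 ->
  let phiN := induced_endo i phi in
  let gN := induced_metric i g in
  let zeta := normalized gN (tangential_part i g Z1) in
  let omega := dual_form gN zeta in
  [/\ contact_form omega /\ reeb_field omega zeta,
      almost_contact_metric phiN zeta omega gN /\
        ~ contact_metric phiN zeta omega gN &
      normal_contact_pair a1 a2 Z1 Z2 phi ->
        normal_almost_contact phiN zeta omega].
Proof.
move=> mcp _ sub [p _] n3 inv nt _ no _ phiN gN zeta omega; split; first split.
- exact: (induced_contact_form mcp sub inv nt no n3 p).
- exact: (induced_reeb mcp sub inv nt no).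
- split; first exact: (induced_almost_contact mcp sub inv nt no p).
  exact: (induced_not_contact_metric mcp sub inv nt no n3 p).
- exact: (induced_normal mcp sub inv nt no).
Qed.
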